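(* Let $\mathcal M\in\mathbf{HC}$ be transitive, let $\pi\in\mathcal M$ be a small multiforcing, and let $\rho$ be an $\mathcal M$-generic refinement of $\pi$. If $\eta\in|\pi|\subseteq\mathcal M$ and $c\in\mathcal M$ is a $\pi$-complete real name that is non-principal over $\pi$ at $\eta$, then $\rho$ avoids $c$ over $\pi$ at $\eta$.
   Context: $\mathbf{HC}$: hereditarily countable sets; for $\mathcal M\in\mathbf{HC}$, $\mathcal M^+$ is the set of all $X\in\mathbf{HC}$ definable in $\langle\mathbf{HC},\in\rangle$ with parameters from $\mathcal M$. $\mathbf{PT}$: perfect trees $T\subseteq2^{<\omega}$; $[T]$ branches; $T|s=\{t\in T:s\subseteq t\lor t\subseteq s\}$; trees a.d. if their intersection is finite. Arboreal forcing: $\mathbb P\subseteq\mathbf{PT}$ with $T|u\in\mathbb P$ whenever $u\in T\in\mathbb P$; $\mathbb P^{\cup}$ = finite unions of its trees. $\mathbb P\sqsubset\mathbb Q$: every $T\in\mathbb P$ contains some $Q\in\mathbb Q$; every $Q\in\mathbb Q$ is covered by finitely many trees of $\mathbb P$; for $Q\in\mathbb Q,T\in\mathbb P$, $[Q]\cap[T]$ is clopen in $[Q]$ and $T\not\subseteq Q$. Multiforcing: function $\pi$, domain $|\pi|\subseteq\omega_1$, arboreal forcings as values; small if $|\pi|$ and all values countable; $\pi\sqsubset\rho$ iff $|\pi|\subseteq|\rho|$ and $\pi(\xi)\sqsubset\rho(\xi)$ for $\xi\in|\pi|$. Multitree: function $p$ with finite domain $|p|\subseteq\omega_1$ and values in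 $\mathbf{PT}$; $[p]=\{x\in(2^\omega)^{\omega_1}:\forall\xi\in|p|\,x(\xi)\in[p(\xi)]\}$; $\mathrm{MT}$ = all multitrees; $\mathrm{MT}(\pi)=\{p:|p|\subseteq|\pi|,\ p(\xi)\in\pi(\xi)\}$; $q\le p$ iff $|p|\subseteq|q|$ and $q(\xi)\subseteq p(\xi)$ for $\xi\in|p|$. $p,q$ are sad if $p(\xi),q(\xi)$ are a.d. for some $\xi\in|p|\cap|q|$. Sealing: $u\sqsubseteq^{\mathrm{fin}}\bigvee Z$ means some finite $Z'\subseteq Z$ has $|v|=|u|$ for $v\in Z'$ and $[u]\subseteq\bigcup_{v\in Z'}[v]$. For $\Delta\subseteq\mathrm{MT}(\pi)$, $\pi\sqsubset_\Delta\rho$ means $\pi\sqsubset\rho$ and: whenever $p\in\mathrm{MT}(\pi)$, $u\in\mathrm{MT}(\rho)$, $|u|\subseteq|\pi|$, $|u|\cap|p|=\emptyset$, there is $q\in\mathrm{MT}(\pi)$, $q\le p$, $|q|\cap|u|=\emptyset$, with $u\sqsubseteq^{\mathrm{fin}}\bigvee\{u'\in\mathrm{MT}(\pi):|u'|=|u|,\ u'\cup q\in\Delta\}$. Real names: a real name is $c\subseteq\mathrm{MT}\times(\omega\times2)$ such that with $K_{n,i}=\{p:\langle p,n,i\rangle\in c\}$ any $p\in K_{n,0},q\in K_{n,1}$ are sad; $K_n=K_{n,0}\cup K_{n,1}$; $c$ is $\pi$-complete if each $\{p\in\mathrm{MT}(\pi):\exists q\in K_n\,p\le q\}$ is pre-dense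 in $\mathrm{MT}(\pi)$. $p$ directly forces $c(n)=i$ if $p\le q$ for some $q\in K_{n,i}$; directly forces $s\subset c$ if it directly forces $c(n)=s(n)$ for $n<\mathrm{lh}(s)$; directly forces $c\notin[T]$ if it directly forces $s\subset c$ for some $s\in2^{<\omega}\setminus T$. $c$ is non-principal over $\pi$ at $\xi\in|\pi|$ if $\{p\in\mathrm{MT}(\pi):\xi\in|p|\text{ and }p\text{ directly forces }c\notin[p(\xi)]\}$ is open dense in $\mathrm{MT}(\pi)$. For $\pi\sqsubset\rho$ and $\xi\in|\pi|$, $\rho$ avoids $c$ over $\pi$ at $\xi$ if for every $Q\in\rho(\xi)$, $\pi\sqsubset_{\Delta_Q}\rho$ where $\Delta_Q=\{r\in\mathrm{MT}(\pi):\xi\in|r|\text{ and }r\text{ directly forces }c\notin[Q]\}$. Generic refinement: on $\omega\times\mathbf{PT}$, $\langle n,T\rangle\preccurlyeq\langle m,S\rangle$ iff $m\le n$, $T\subseteq S$, $T\cap2^m=S\cap2^m$. A $\pi$-system is a function $\varphi$ with finite domain $|\varphi|\subseteq|\pi|\times\omega$, $\varphi(\xi,k)\in\pi(\xi)^{\cup}$; $\langle n,\varphi\rangle\preccurlyeq\langle m,\psi\rangle$ iff $|\psi|\subseteq|\varphi|$ and $\langle n,\varphi(\xi,k)\rangle\preccurlyeq\langle m,\psi(\xi,k)\rangle$ for $\langle\xi,k\rangle\in|\psi|$. Take a $\preccurlyeq$-decreasing sequence $\langle\langle n_j,\varphi_j\rangle\rangle_{j<\omega}$, $n_0<n_1<\cdots$,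 meeting every open dense set of such pairs in $\mathcal M^+$; let $Q_{\xi k}=\bigcap_{j\ge j(\xi,k)}\varphi_j(\xi,k)$ (with $\langle\xi,k\rangle\in|\varphi_j|$ for $j\ge j(\xi,k)$) and $\rho(\xi)=\{Q_{\xi k}|s:k<\omega,s\in Q_{\xi k}\}$ for $\xi\in|\pi|$; $\rho$ is an $\mathcal M$-generic refinement of $\pi$. *)

(* Defs.v *)
From HB Require Import structures.
From mathcomp Require Import all_boot all_order generic_quotient finmap.
From mathcomp Require Import boolp classical_sets functions cardinality.
From mathcomp Require Import topology cantor.

Set Implicit Arguments.
Unset Strict Implicit.
Unset Printing Implicit Defensive.

Local Open Scope classical_set_scope.

(* A hereditarily countable set is presented by a well-founded, countably
   branching tree: [hc_empty] presents the empty set and [hc_sup f] presents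
   the set of the sets presented by f 0, f 1, and so on.  [HC] is the
   quotient by extensional equality; [elts_inj] and [elts_hset] below show
   that an element of [HC] is determined by its elements and that every
   countable set of elements of [HC] is (the extension of) an element of
   [HC]. *)

Inductive hcpre : Type :=
  | hc_empty
  | hc_sup of (nat -> hcpre).

Fixpoint heq (x y : hcpre) {struct x} : Prop :=
  match x, y with
  | hc_empty, hc_empty => True
  | hc_sup f, hc_sup g =>
      (forall n, exists m, heq (f n) (g m)) /\
      (forall m, exists n, heq (f n) (g m))
  | _, _ => False
  end.

Definition premem (x y : hcpre) : Prop :=
  if y is hc_sup g then exists n, heq x (g n) else False.

Lemma heq_refl x : heq x x.
Proof. by elim: x => //= f IH; split=> n; exists n. Qed.

Lemma heq_sym x y : heq x y -> heq y x.
Proof.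
elim: x y => [|f IH] [|g] //= [fg gf]; split=> n.
- by have [m /IH] := gf n; exists m.
- by have [m /IH] := fg n; exists m.
Qed.

Lemma heq_trans x y z : heq x y -> heq y z -> heq x z.
Proof.
elim: x y z => [|f IH] [|g] [|h] //= [fg gf] [gh hg]; split=> n.
- have [m fgm] := fg n; have [k ghk] := gh m.
  by exists k; apply: IH fgm ghk.
- have [m ghm] := hg n; have [k fgk] := gf m.
  by exists k; apply: IH fgk ghm.
Qed.

HB.instance Definition _ := gen_eqMixin hcpre.
HB.instance Definition _ := gen_choiceMixin hcpre.

Definition heqb (x y : hcpre) : bool := `[< heq x y >].

Lemma heqb_equiv : equiv_class_of heqb.
Proof.
split=> [x|x y|y x z]; first exact/asboolP/heq_refl.
- by apply/asboolP/asboolP => /heq_sym.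
- by move=> /asboolP xy /asboolP yz; apply/asboolP/(heq_trans xy yz).
Qed.

Canonical heqb_equivRel := EquivRelPack heqb_equiv.

Definition HC : choiceType := {eq_quot heqb}%qT.

Definition hin (x y : HC) : Prop := premem (repr x) (repr y).

Definition elts (x : HC) : set HC := [set y | hin y x].

Definition hempty : HC := (\pi_HC hc_empty)%qT.

(* The element of HC with extension A if there is one, i.e. (elts_hset) if A
   is countable; otherwise the empty set. *)
Definition hset (A : set HC) : HC := xget hempty [set x | elts x = A].

Lemma heq_pi (x y : hcpre) :
  (\pi_HC x)%qT = (\pi_HC y)%qT <-> heq x y.
Proof.
by split=> [/eqquotP/asboolP//|h]; apply/eqquotP/asboolP.
Qed.

Lemma heq_repr (x : hcpre) : heq (repr (\pi_HC x)%qT) x.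
Proof. by apply/heq_pi; rewrite reprK. Qed.

Lemma premem_heq x y y' : heq y y' -> premem x y -> premem x y'.
Proof.
case: y y' => [|g] [|g'] //= [gg' _] [n xg].
by have [m gm] := gg' n; exists m; apply: heq_trans xg gm.
Qed.

Lemma elts_sup (f : nat -> hcpre) :
  elts (\pi_HC (hc_sup f))%qT = range (fun n => (\pi_HC (f n))%qT).
Proof.
apply/seteqP; split=> [x xf|_ [n _ <-]].
- have [n xn] : premem (repr x) (hc_sup f) by apply: premem_heq xf; exact: heq_repr.
  by exists n => //; rewrite -[RHS]reprK; apply/heq_pi/heq_sym.
- apply: (@premem_heq _ (hc_sup f)); first exact/heq_sym/heq_repr.
  by exists n; exact: heq_repr.
Qed.

Lemma elts_empty : elts hempty = set0.
Proof.
apply/seteqP; split=> // x /(premem_heq (heq_repr hc_empty)) //.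
Qed.

Lemma elts_countable x : countable (elts x).
Proof.
rewrite -[x]reprK; case: (repr x) => [|f].
- by rewrite -/hempty elts_empty; exact: countable0.
- by rewrite elts_sup; apply: sub_countable (card_image_le _ _) _; exact: countableP.
Qed.

Lemma elts_inj : injective elts.
Proof.
move=> x y; rewrite -[x]reprK -[y]reprK.
case: (repr x) (repr y) => [|f] [|g]; rewrite -/hempty ?elts_empty ?elts_sup //.
- by move/seteqP => [_ /(_ _ (imageT _ 0))].
- by move/seteqP => [/(_ _ (imageT _ 0))].
- move=> /seteqP[fg gf]; apply/heq_pi; split=> n.
  + by have [m _ /heq_pi/heq_sym] := fg _ (imageT _ n); exists m.
  + by have [m _ /heq_pi] := gf _ (imageT _ n); exists m.
Qed.

Lemma elts_hset (A : set HC) : countable A -> elts (hset A) = A.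
Proof.
move=> cA; rewrite /hset; case: xgetP => [x _ -> //|noA]; exfalso.
have [A0|/set0P A0] := eqVneq A set0.
  by apply: (noA hempty); rewrite /= elts_empty A0.
have [f fA] : exists f : nat -> HC, range f = A.
  have [a Aa] := A0; have /pcard_leP[g] := cA.
  pose inv n := [set x | A x /\ g x = n].
  exists (fun n => xget a (inv n)); apply/seteqP; split=> [_ [n _ <-]|x Ax].
    by case: xgetP => [y _ []|].
  exists (g x) => //; case: xgetP => [y _ [Ay gyx]|/(_ x)[]//].
  by apply: (@inj _ _ _ g); rewrite ?inE.
apply: (noA (\pi_HC (hc_sup (fun n => repr (f n))))%qT).
by rewrite /= elts_sup -fA; congr image; apply/funext => n; rewrite reprK.
Qed.

Inductive fml : Type :=
  | Feq of nat & nat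
  | Fin of nat & nat
  | Fnot of fml
  | Fand of fml & fml
  | Fall of fml.

(* The variables are de Bruijn indices into the environment e, so Fall binds
   index 0.  Indices beyond the environment denote the empty set, which is definable
   without parameters. *)
Fixpoint sat (e : seq HC) (f : fml) : Prop :=
  match f with
  | Feq i j => nth hempty e i = nth hempty e j
  | Fin i j => hin (nth hempty e i) (nth hempty e j)
  | Fnot g => ~ sat e g
  | Fand g h => sat e g /\ sat e h
  | Fall g => forall x : HC, sat (x :: e) g
  end.

Definition hplus (M : HC) : set HC :=
  [set X | exists (f : fml) (e : seq HC),
     (forall y, y \in e -> elts M y) /\
     forall Y, sat (Y :: e) f <-> Y = X].

Definition htransitive (x : HC) : Prop :=
  forall y, elts x y -> elts y `<=` elts x.

(* Kuratowski pairs, von Neumann numbers, functions as sets of pairs. *)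

Definition hpair (x y : HC) : HC :=
  hset [set hset [set x]; hset [set x; y]].

Fixpoint hnat (n : nat) : HC :=
  if n is m.+1 then hset (hnat m |` elts (hnat m)) else hempty.

Definition hseq (s : seq bool) : HC :=
  hset [set hpair (hnat i) (hnat (nth false s i)) | i in [set i | i < size s]].

(* "A is an element of V", where A itself is given by its elements; in
   particular A is then countable. *)
Definition set_in (A V : set HC) : Prop := exists2 x, V x & elts x = A.

(* omega_1: the von Neumann ordinals of HC are the countable ordinals
   (membership is well-founded in HC). *)
Definition vN_ordinal (x : HC) : Prop :=
  htransitive x /\ forall y, elts x y -> htransitive y.

Definition omega1 : choiceType := {x : HC | `[< vN_ordinal x >]}.

Definition tree : Type := set (seq bool).

Definition PT : set tree :=
  [set T | [/\ T !=set0,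
     (forall s t, prefix s t -> T t -> T s) &
     forall s, T s -> exists t,
       [/\ prefix s t, T (rcons t false) & T (rcons t true)]]].

Definition branches (T : tree) : set cantor_space :=
  [set a | forall n, T (mkseq a n)].

Definition restr (T : tree) (s : seq bool) : tree :=
  [set t | T t /\ (prefix s t || prefix t s)].

Definition almost_disjoint (S T : tree) : Prop := finite_set (S `&` T).

Definition arboreal (P : set tree) : Prop :=
  P `<=` PT /\ forall T u, P T -> T u -> P (restr T u).

(* Unions of finitely many, and at least one, trees of P: these are to be
   perfect trees again. *)
Definition fin_unions (P : set tree) : set tree :=
  [set T | exists F : set tree,
     [/\ finite_set F, F !=set0, F `<=` P & T = \bigcup_(S in F) S]].

Definition refines_forcing (P Q : set tree) : Prop :=
  [/\ (forall T, P T -> exists2 S, Q S & S `<=` T),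
      (forall S, Q S -> exists F : set tree,
         [/\ finite_set F, F `<=` P & S `<=` \bigcup_(T in F) T]) &
      forall S T, Q S -> P T ->
        @clopen (subspace (branches S)) (branches S `&` branches T) /\
        ~ (T `<=` S)].

Definition multi : Type := omega1 -> option (set tree).

Definition mdom (pi : multi) : set omega1 := [set xi | isSome (pi xi)].

(* Meaningful only on mdom pi. *)
Definition mval (pi : multi) (xi : omega1) : set tree := odflt set0 (pi xi).

Definition multiforcing (pi : multi) : Prop :=
  forall xi, mdom pi xi -> arboreal (mval pi xi).

Definition small (pi : multi) : Prop :=
  countable (mdom pi) /\ forall xi, mdom pi xi -> countable (mval pi xi).

Definition refines (pi rho : multi) : Prop :=
  mdom pi `<=` mdom rho /\
  forall xi, mdom pi xi -> refines_forcing (mval pi xi) (mval rho xi).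

Definition mtree : Type := {fmap omega1 -> tree}.

(* Meaningful only on the domain. *)
Definition app (K : choiceType) (p : {fmap K -> tree}) (k : K) : tree :=
  odflt set0 p.[? k]%fmap.

Definition MT : set mtree := [set p | forall xi, xi \in domf p -> PT (app p xi)].

Definition MTof (pi : multi) : set mtree :=
  [set p | forall xi, xi \in domf p -> mdom pi xi /\ mval pi xi (app p xi)].

Definition box (p : mtree) : set (omega1 -> cantor_space) :=
  [set x | forall xi, xi \in domf p -> branches (app p xi) (x xi)].

Definition stronger (q p : mtree) : Prop :=
  (domf p `<=` domf q)%fset /\
  forall xi, xi \in domf p -> app q xi `<=` app p xi.

Definition sad (p q : mtree) : Prop :=
  exists xi, [/\ xi \in domf p, xi \in domf q &
                 almost_disjoint (app p xi) (app q xi)].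

Definition dense_in (pi : multi) (D : set mtree) : Prop :=
  forall p, MTof pi p -> exists q, [/\ MTof pi q, D q & stronger q p].

Definition open_in (pi : multi) (D : set mtree) : Prop :=
  forall p q, D p -> MTof pi q -> stronger q p -> D q.

Definition open_dense_in (pi : multi) (D : set mtree) : Prop :=
  [/\ D `<=` MTof pi, open_in pi D & dense_in pi D].

Definition predense_in (pi : multi) (D : set mtree) : Prop :=
  D `<=` MTof pi /\
  forall p, MTof pi p -> exists r q,
    [/\ MTof pi r, D q, stronger r p & stronger r q].

Definition fin_below (u : mtree) (Z : set mtree) : Prop :=
  exists Z' : set mtree,
    [/\ finite_set Z', Z' `<=` Z, (forall v, Z' v -> domf v = domf u) &
        box u `<=` \bigcup_(v in Z') box v].

Definition refines_sealing (pi : multi) (Delta : set mtree) (rho : multi) : Prop :=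
  refines pi rho /\
  forall p u, MTof pi p -> MTof rho u ->
    (forall xi, xi \in domf u -> mdom pi xi) ->
    [disjoint domf u & domf p]%fset ->
    exists q, [/\ MTof pi q, stronger q p, [disjoint domf q & domf u]%fset &
      fin_below u [set u' | [/\ MTof pi u', domf u' = domf u &
                                Delta (catf u' q)]]].

Definition name : Type := set (mtree * (nat * bool)).

Definition Kset (c : name) (n : nat) (i : bool) : set mtree :=
  [set p | c (p, (n, i))].

Definition real_name (c : name) : Prop :=
  (forall p n i, c (p, (n, i)) -> MT p) /\
  forall n p q, Kset c n false p -> Kset c n true q -> sad p q.

Definition complete_name (pi : multi) (c : name) : Prop :=
  forall n, predense_in pi
    [set p | MTof pi p /\
       exists2 q, (Kset c n false `|` Kset c n true) q & stronger p q].

Definition forces_val (c : name) (p : mtree) (n : nat) (i : bool) : Prop :=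
  exists2 q, Kset c n i q & stronger p q.

Definition forces_init (c : name) (p : mtree) (s : seq bool) : Prop :=
  forall n, n < size s -> forces_val c p n (nth false s n).

Definition forces_notin (c : name) (p : mtree) (T : tree) : Prop :=
  exists2 s, ~ T s & forces_init c p s.

Definition nonprincipal (pi : multi) (c : name) (xi : omega1) : Prop :=
  mdom pi xi /\
  open_dense_in pi
    [set p | [/\ MTof pi p, xi \in domf p & forces_notin c p (app p xi)]].

Definition avoids (pi rho : multi) (c : name) (xi : omega1) : Prop :=
  [/\ refines pi rho, mdom pi xi &
      forall Q, mval rho xi Q ->
        refines_sealing pi
          [set r | [/\ MTof pi r, xi \in domf r & forces_notin c r Q]] rho].

Definition system : Type := {fmap (omega1 * nat) -> tree}.

Definition is_system (pi : multi) (phi : system) : Prop :=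
  forall xi k, (xi, k) \in domf phi ->
    mdom pi xi /\ fin_unions (mval pi xi) (app phi (xi, k)).

Definition level (T : tree) (m : nat) : tree := T `&` [set s | size s = m].

Definition tle (nT mS : nat * tree) : Prop :=
  [/\ mS.1 <= nT.1, nT.2 `<=` mS.2 & level nT.2 mS.1 = level mS.2 mS.1].

Definition cond : Type := (nat * system)%type.

Definition conds (pi : multi) : set cond := [set d | is_system pi d.2].

Definition cle (d e : cond) : Prop :=
  (domf e.2 `<=` domf d.2)%fset /\
  forall x, x \in domf e.2 -> tle (d.1, app d.2 x) (e.1, app e.2 x).

Definition open_dense_conds (pi : multi) (D : set cond) : Prop :=
  [/\ D `<=` conds pi,
      (forall d e, D e -> conds pi d -> cle d e -> D d) &
      forall e, conds pi e -> exists2 d, D d & cle d e].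

Definition htree (T : tree) : HC := hset (hseq @` T).

Definition hmtree (p : mtree) : HC :=
  hset [set hpair (val xi) (htree (app p xi)) | xi in [set` domf p]].

Definition hname (x : mtree * (nat * bool)) : HC :=
  hpair (hmtree x.1) (hpair (hnat x.2.1) (hnat x.2.2)).

(* The inner hset is meaningful when mval pi xi is countable, in particular
   when pi is small. *)
Definition hmulti (pi : multi) : set HC :=
  [set hpair (val xi) (hset (htree @` mval pi xi)) | xi in mdom pi].

Definition hsystem (phi : system) : HC :=
  hset [set hpair (hpair (val x.1) (hnat x.2)) (htree (app phi x))
       | x in [set` domf phi]].

Definition hcond (d : cond) : HC := hpair (hnat d.1) (hsystem d.2).

(* The set of all Q_{xi k}|s, where Q_{xi k} is the intersection of the
   phi_j(xi,k) over a final segment of j's on which they are all defined; by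
   monotonicity it does not depend on the final segment. *)
Definition limit_forcing (d : nat -> cond) (xi : omega1) : set tree :=
  [set T | exists k j0 s,
     let Q := \bigcap_(j in [set j | j0 <= j]) app (d j).2 (xi, k) in
     [/\ (forall j, j0 <= j -> (xi, k) \in domf (d j).2), Q s & T = restr Q s]].

Definition generic_refinement (M : HC) (pi rho : multi) : Prop :=
  exists d : nat -> cond,
    [/\ (forall j, conds pi (d j)),
        (forall j, (d j).1 < (d j.+1).1 /\ cle (d j.+1) (d j)),
        (forall D : set cond, open_dense_conds pi D ->
           set_in (hcond @` D) (hplus M) -> exists j, D (d j)) &
        forall xi, rho xi =
          if isSome (pi xi) then Some (limit_forcing d xi) else None].

(* Main.v *)
Require Import Defs.
From mathcomp Require Import all_boot all_order finmap.
From mathcomp Require Import boolp classical_sets functions cardinality.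
From mathcomp Require Import topology cantor.

(* Every tree Q of rho is contained in the trees d_j(xi, k) of the generic sequence, so each
   requirement only has to be met by one d_j, hence by a dense open set of conditions in M^+.
   The main such set: given (m, psi), split each tree psi(xi, k) into the pieces psi(xi, k)|s with
   s of length m, and run through the finitely many ways to pick one piece for each xi in |u|.
   The picked pieces together with q form a multitree of MT(pi); by non-principality it has a
   strengthening r that directly forces a sequence a outside r(eta) to be an initial segment
   of c, and by completeness a can be made as long as we like.  Replacing the picked pieces and q by
   those of r, and shrinking each remaining piece W of psi(eta, K) to W|w with w in W different
   from a and of the same length, gives c notin [psi(eta, K)] for this choice; later shrinkings keep it.
   Membership of the dense sets in M^+ is obtained by coding the objects involved in HC and
   closing the predicates definable over HC under the logical operations. *)

Set Implicit Arguments.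
Unset Strict Implicit.
Unset Printing Implicit Defensive.

Local Open Scope classical_set_scope.

(** * Definability over HC with parameters *)


(** Q and the trees u(xi) come from the generic sequence and cannot serve as parameters of a dense
    set. They enter only through finite data: p, the set A = |u|, and indices with u(xi) inside
    Q_{xi, kappa xi} and Q inside Q_{eta, K}. This is why the requirement speaks of psi(eta, K)
    instead of Q and of all combinations of pieces instead of u. The delicate case is eta in A with
    kappa eta = K. The picked piece of psi(eta, K) then has to become r(eta), so there is no freedom
    left to steer it away from a; non-principality settles exactly this, because a lies outside
    r(eta). Every other piece of psi(eta, K) can be steered away as soon as a is long enough to
    leave the piece a second node of the same length. M is transitive but not assumed closed under
    pairing, so finite objects such as p are treated as definable constants, not as parameters. That
    rho refines pi is part of the conclusion and is obtained from three more families of dense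
    sets. *)

Definition scons (x : HC) (v : nat -> HC) : nat -> HC :=
  fun n => if n is m.+1 then v m else x.

(** With total valuations in place of lists, renaming variables is composition of functions
    ([satv_ren]). *)
Fixpoint satv (v : nat -> HC) (f : fml) : Prop :=
  match f with
  | Feq i j => v i = v j
  | Fin i j => hin (v i) (v j)
  | Fnot g => ~ satv v g
  | Fand g h => satv v g /\ satv v h
  | Fall g => forall x, satv (scons x v) g
  end.

Lemma nth_scons x e : nth hempty (x :: e) = scons x (nth hempty e).
Proof. by apply/funext => -[]. Qed.

Lemma sat_satv e f : sat e f <-> satv (nth hempty e) f.
Proof.
elim: f e => [i j|i j|g IH|g IHg h IHh|g IH] e //=.
- by rewrite IH.
- by rewrite IHg IHh.
- by split=> H x; have := H x; rewrite IH nth_scons.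
Qed.

Fixpoint ren (r : nat -> nat) (f : fml) : fml :=
  match f with
  | Feq i j => Feq (r i) (r j)
  | Fin i j => Fin (r i) (r j)
  | Fnot g => Fnot (ren r g)
  | Fand g h => Fand (ren r g) (ren r h)
  | Fall g => Fall (ren (fun n => if n is m.+1 then (r m).+1 else 0) g)
  end.

Lemma satv_ren r v f : satv v (ren r f) <-> satv (v \o r) f.
Proof.
elim: f r v => [i j|i j|g IH|g IHg h IHh|g IH] r v //=.
- by rewrite IH.
- by rewrite IHg IHh.
- have E x : scons x v \o (fun n => if n is m.+1 then (r m).+1 else 0)
      = scons x (v \o r) by apply/funext => -[].
  by split=> H x; have := H x; rewrite IH E.
Qed.

(** Interleaving leaves infinitely many indices both to the free variables and to the parameters, so
    neither side needs a bound. *)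
Definition mix (v w : nat -> HC) : nat -> HC :=
  fun i => if odd i then w i./2 else v i./2.

Lemma mix_even v w i : mix v w i.*2 = v i.
Proof. by rewrite /mix odd_double doubleK. Qed.

Lemma mix_odd v w i : mix v w i.*2.+1 = w i.
Proof. by rewrite /mix /= odd_double /= uphalf_double. Qed.

(* The even variables are free, the odd ones stand for the parameters from M. *)
Definition pdef (M : HC) (P : (nat -> HC) -> Prop) : Prop :=
  exists (f : fml) (e : seq HC), (forall y, y \in e -> elts M y) /\
    forall v, satv (mix v (nth hempty e)) f <-> P v.

Lemma pdef_ext M P Q : (forall v, P v <-> Q v) -> pdef M P -> pdef M Q.
Proof. by move=> PQ [f [e [eM fP]]]; exists f, e; split=> // v; rewrite fP. Qed.

Lemma pdef_ren M r P : pdef M P -> pdef M (fun v => P (v \o r)).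
Proof.
move=> [f [e [eM fP]]].
exists (ren (fun i => if odd i then i else (r i./2).*2) f), e; split=> // v.
rewrite satv_ren -fP.
suff -> : mix v (nth hempty e) \o (fun i => if odd i then i else (r i./2).*2)
  = mix (v \o r) (nth hempty e) by [].
apply/funext => i /=; case: ifP => oi; rewrite ?mix_even /mix oi //.
Qed.

Lemma pdef_eq M i j : pdef M (fun v => v i = v j).
Proof. by exists (Feq i.*2 j.*2), [::]; split=> // v /=; rewrite !mix_even. Qed.

Lemma pdef_in M i j : pdef M (fun v => hin (v i) (v j)).
Proof. by exists (Fin i.*2 j.*2), [::]; split=> // v /=; rewrite !mix_even. Qed.

Lemma pdef_param M a i : elts M a -> pdef M (fun v => v i = a).
Proof.
move=> Ma; exists (Feq i.*2 1), [:: a]; split=> [y|v /=].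
  by rewrite inE => /eqP->.
by rewrite mix_even (mix_odd v _ 0).
Qed.

Lemma pdef_not M P : pdef M P -> pdef M (fun v => ~ P v).
Proof.
by move=> [f [e [eM fP]]]; exists (Fnot f), e; split=> // v /=; rewrite fP.
Qed.

Lemma pdef_and M P Q : pdef M P -> pdef M Q -> pdef M (fun v => P v /\ Q v).
Proof.
move=> [f [e [eM fP]]] [g [d [dM gQ]]].
(* For [f] a parameter index beyond [e] denotes the empty set; in [e ++ d] it is moved past [d] as
   well, so that it still does. *)
pose rf i := if odd i && (size e <= i./2) then (i./2 + size d).*2.+1 else i.
pose rg i := if odd i then (i./2 + size e).*2.+1 else i.
exists (Fand (ren rf f) (ren rg g)), (e ++ d); split=> [y|v /=].
  by rewrite mem_cat => /orP[/eM|/dM].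
rewrite !satv_ren -fP -gQ.
suff [-> ->] : mix v (nth hempty (e ++ d)) \o rf = mix v (nth hempty e) /\
  mix v (nth hempty (e ++ d)) \o rg = mix v (nth hempty d) by [].
split; apply/funext => i /=; rewrite /rf /rg.
- case: ifPn => [/andP[oi ei]|]; last first.
    by rewrite negb_and -ltnNge /mix; case: (odd i) => //= lie; rewrite nth_cat lie.
  rewrite mix_odd /mix oi !nth_default // size_cat.
  by rewrite leq_add2r.
- case: ifPn => oi; last by rewrite /mix (negbTE oi).
  by rewrite mix_odd /mix oi nth_cat ltnNge leq_addl /= addnK.
Qed.

Lemma pdef_all M (Q : HC -> (nat -> HC) -> Prop) :
  pdef M (fun v => Q (v 0) (fun n => v n.+1)) -> pdef M (fun v => forall x, Q x v).
Proof.
move=> [f [e [eM fP]]].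
(* Index 0 is the bound variable. A parameter index moves up by one past it, while the even index 2i
   + 2, which is the outer free variable i, moves down to 2i + 1. *)
pose r n := if n is m.+1 then if odd n then n.+1 else m else 0.
exists (Fall (ren r f)), e; split=> // v /=.
suff E x : scons x (mix v (nth hempty e)) \o r = mix (scons x v) (nth hempty e).
  by split=> H x; have := H x; rewrite satv_ren E fP.
apply/funext => -[|i] //=; rewrite /r /mix; case: ifPn => oi /=; first by rewrite oi.
by case: i oi => //= i; rewrite !negbK => oi; rewrite (negbTE oi).
Qed.

Lemma pdef_imp M P Q : pdef M P -> pdef M Q -> pdef M (fun v => P v -> Q v).
Proof.
move=> dP dQ; apply: (@pdef_ext _ (fun v => ~ (P v /\ ~ Q v))).
  by move=> v; rewrite not_andE notK implyE.
exact/pdef_not/pdef_and/pdef_not.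
Qed.

Lemma pdef_or M P Q : pdef M P -> pdef M Q -> pdef M (fun v => P v \/ Q v).
Proof.
move=> dP dQ; apply: (@pdef_ext _ (fun v => ~ P v -> Q v)).
  by move=> v; rewrite implyE notK.
exact/pdef_imp/dQ/pdef_not.
Qed.

Lemma pdef_iff M P Q : pdef M P -> pdef M Q -> pdef M (fun v => P v <-> Q v).
Proof. by move=> dP dQ; apply: pdef_and; apply: pdef_imp. Qed.

Lemma pdef_ex M (Q : HC -> (nat -> HC) -> Prop) :
  pdef M (fun v => Q (v 0) (fun n => v n.+1)) -> pdef M (fun v => exists x, Q x v).
Proof.
move=> dQ; apply: (@pdef_ext _ (fun v => ~ forall x, ~ Q x v)).
  by move=> v; rewrite -existsNE; split=> -[x]; [move/contrapT|]; exists x => //; apply.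
exact/pdef_not/(pdef_all (Q := fun x v => ~ Q x v))/pdef_not.
Qed.

Definition cdef (M : HC) (S : set HC) : Prop := pdef M (fun v => S (v 0)).

Lemma pdef_class M S i : cdef M S -> pdef M (fun v => S (v i)).
Proof. exact: (pdef_ren (fun=> i)). Qed.

Ltac pdef_step :=
  cbv beta;
  lazymatch goal with
  | |- pdef _ (fun v => _ /\ _) => apply: pdef_and
  | |- pdef _ (fun v => _ \/ _) => apply: pdef_or
  | |- pdef _ (fun v => _ <-> _) => apply: pdef_iff
  | |- pdef _ (fun v => ~ _) => apply: pdef_not
  | |- pdef _ (fun v => @?P v -> @?Q v) => refine (pdef_imp (P := P) (Q := Q) _ _)
  | |- pdef _ (fun v => exists x, @?Q v x) =>
      refine (pdef_ex (Q := fun x v => Q v x) _)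
  | |- pdef _ (fun v => forall x, @?Q v x) =>
      refine (pdef_all (Q := fun x v => Q v x) _)
  | |- pdef _ (fun v => v ?i = v ?j) => exact: (pdef_eq _ i j)
  | |- pdef _ (fun v => hin (v ?i) (v ?j)) => exact: (pdef_in _ i j)
  | |- pdef _ (fun v => ?S (v ?i)) => refine (pdef_class (S := S) i _); try assumption
  end.

Definition upair (x y : HC) : HC := hset [set x; y].

Lemma hin_upair z x y : hin z (upair x y) <-> z = x \/ z = y.
Proof.
have -> : hin z (upair x y) = elts (upair x y) z by [].
by rewrite elts_hset //; exact/finite_set_countable.
Qed.

Lemma hpairE x y : hpair x y = upair (upair x x) (upair x y).
Proof. by rewrite /upair setUid. Qed.

Lemma elts_ext x y : (forall z, hin z x <-> hin z y) -> x = y.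
Proof. by move=> xy; apply: elts_inj; apply/seteqP; split=> z /xy. Qed.

Lemma upair_eqP x y w : w = upair x y <-> forall z, hin z w <-> z = x \/ z = y.
Proof.
split=> [-> z|H]; first exact: hin_upair.
by apply: elts_ext => z; rewrite hin_upair.
Qed.

Lemma hpair_eqP x y w : w = hpair x y <->
  exists a b, a = upair x x /\ b = upair x y /\ w = upair a b.
Proof. by rewrite hpairE; split=> [->|[a [b [-> [-> ->]]]] //]; do 2!eexists. Qed.

Lemma upair_inj a b c d : upair a b = upair c d ->
  (a = c /\ b = d) \/ (a = d /\ b = c).
Proof.
move=> E; have P z : (z = a \/ z = b) <-> (z = c \/ z = d).
  by rewrite -!hin_upair E.
have := (P a).1 (or_introl erefl); have := (P b).1 (or_intror erefl).
have := (P c).2 (or_introl erefl); have := (P d).2 (or_intror erefl).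
by clear; intuition congruence.
Qed.

Lemma hpair_inj a b c d : hpair a b = hpair c d -> a = c /\ b = d.
Proof.
rewrite !hpairE => /upair_inj[] [] /upair_inj + /upair_inj; clear; intuition congruence.
Qed.

Lemma pdef_upair M i j k : pdef M (fun v => v i = upair (v j) (v k)).
Proof.
apply: (@pdef_ext _ (fun v => forall z, hin z (v i) <-> z = v j \/ z = v k)).
  by move=> v; rewrite upair_eqP.
by repeat pdef_step.
Qed.

Lemma pdef_hpair M i j k : pdef M (fun v => v i = hpair (v j) (v k)).
Proof.
apply: (@pdef_ext _ (fun v => exists a b, a = upair (v j) (v j) /\
   b = upair (v j) (v k) /\ v i = upair a b)).
  by move=> v; rewrite hpair_eqP.
by do !pdef_step; exact: pdef_upair.
Qed.

Lemma cdef_ext M S T : (forall x, S x <-> T x) -> cdef M S -> cdef M T.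
Proof. by move=> ST; apply: pdef_ext => v. Qed.

(** By extensionality a definition of the elements singles out the set; all free variables are then
    merged into the one variable that [hplus] allows. *)
Lemma hplus_cdef M X : cdef M (elts X) -> hplus M X.
Proof.
move=> dX; have : pdef M (fun v => forall z, hin z (v 0) <-> elts X z).
  by do !pdef_step.
move=> [f [e [eM fP]]].
exists (ren (fun i => if odd i then i./2.+1 else 0) f), e; split=> // Y.
rewrite sat_satv satv_ren.
have -> : nth hempty (Y :: e) \o (fun i => if odd i then i./2.+1 else 0)
   = mix (fun=> Y) (nth hempty e).
  by apply/funext => i; rewrite /mix /=; case: ifP.
by rewrite fP; split=> [|-> //]; exact: elts_ext.
Qed.

(** * Definability of predicates and functions on coded types *)


Lemma hin_hset A z : countable A -> hin z (hset A) <-> A z.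
Proof. by move=> cA; rewrite -[A in _ <-> A z]elts_hset. Qed.

Lemma hin_hempty z : ~ hin z hempty.
Proof. by have : elts hempty = set0 := elts_empty; move=> /seteqP[/(_ z)]. Qed.

Lemma hin_ind (P : HC -> Prop) :
  (forall x, (forall y, hin y x -> P y) -> P x) -> forall x, P x.
Proof.
move=> H x; rewrite -[x]reprK; elim: (repr x) => [|f IH]; apply: H => y.
  by move/hin_hempty.
have -> : hin y (\pi_HC (hc_sup f))%qT = elts (\pi_HC (hc_sup f))%qT y by [].
by rewrite elts_sup => -[n _ <-].
Qed.

Lemma hin_irrefl x : ~ hin x x.
Proof. by apply: (hin_ind (P := fun x => ~ hin x x)) => y IH yy; exact: (IH y yy yy). Qed.

Lemma countable_setU1 (x : HC) A : countable A -> countable (x |` A).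
Proof.
by move=> cA; rewrite -bigcup2E; apply: bigcup_countable => // -[|[|i]] _ //=.
Qed.

Lemma hin_hsucc n z : hin z (hnat n.+1) <-> z = hnat n \/ hin z (hnat n).
Proof. by rewrite hin_hset //; apply/countable_setU1/elts_countable. Qed.

Lemma hin_hnat n z : hin z (hnat n) <-> exists2 m, m < n & z = hnat m.
Proof.
elim: n => [|n IH]; first by split=> [/hin_hempty|[]].
rewrite hin_hsucc IH; split=> [[->|[m mn ->]]|[m]]; first by exists n.
  by exists m => //; exact: ltnW.
by rewrite ltnS leq_eqVlt => /predU1P[->|mn] ->; [left|right; exists m].
Qed.

Lemma hnat_inj : injective hnat.
Proof.
have H m n : m < n -> hnat m <> hnat n.
  by move=> mn E; apply: (@hin_irrefl (hnat n)); apply/hin_hnat; exists m.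
by move=> m n E; case: (ltngtP m n) => // /H; rewrite E.
Qed.

Lemma hin_hnatE m n : hin (hnat m) (hnat n) <-> m < n.
Proof.
by rewrite hin_hnat; split=> [[k kn /hnat_inj->] //|mn]; exists m.
Qed.

Lemma countable_image T U (f : T -> U) (A : set T) : countable A -> countable (f @` A).
Proof. exact/sub_countable/card_image_le. Qed.

Ltac pdefs := repeat first [pdef_step | exact: pdef_hpair | exact: pdef_upair].

(** The set of natural numbers is itself a member of HC, so it is the intersection of all inductive
    sets in HC. *)
Lemma cdef_hnat M : cdef M (range hnat).
Proof.
apply: (@cdef_ext _ (fun x => forall I, (forall e, (forall z, ~ hin z e) -> hin e I) ->
  (forall y, hin y I -> forall s, (forall z, hin z s <-> z = y \/ hin z y) -> hin s I) ->
  hin x I)); last by rewrite /cdef; pdefs.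
move=> x; split=> [|[n _ <-] I I0 IS].
  move/(_ (hset (range hnat))); have c : countable (range hnat) by exact: countable_image.
  rewrite hin_hset //; apply.
    move=> e e0; rewrite hin_hset //; exists 0 => //=.
    by apply: elts_ext => z; split=> [/hin_hempty|/e0].
  move=> y; rewrite !hin_hset // => -[n _ <-] s sE; rewrite hin_hset //; exists n.+1 => //.
  by apply: elts_ext => z; rewrite sE hin_hsucc.
elim: n => [|n IH]; first by apply: I0 => z; exact: hin_hempty.
by apply: IS IH _ _ => z; exact: hin_hsucc.
Qed.

(** [code_def] turns a quantifier over [A] into a quantifier over HC restricted to codes; [code_inj]
    recovers a predicate on [A] from its set of codes. *)
Class coded (A : Type) := Coded {
  code : A -> HC;
  code_inj : injective code;
  code_def : forall M, cdef M (range code) }.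

Definition tdef (M : HC) {A} {CA : coded A} (P : A -> Prop) : Prop :=
  cdef M [set code a | a in [set a | P a]].

#[local] Instance coded_HC : coded HC.
Proof.
exists (fun x => x) => // M; apply: (@cdef_ext _ (fun x => x = x)).
  by move=> x; split=> // _; exists x.
by rewrite /cdef; pdefs.
Defined.

#[local] Instance coded_nat : coded nat := Coded hnat_inj cdef_hnat.

(** Kept transparent: the codes of conditions and of elements of a name must reduce to [hcond] and
    [hname]. *)
#[local] Instance coded_prod A B (CA : coded A) (CB : coded B) : coded (A * B).
Proof.
exists (fun x => hpair (code x.1) (code x.2)) => [[a b] [c d] /= /hpair_inj[]|M].
  by move=> /(@code_inj _ CA) -> /(@code_inj _ CB) ->.
apply: (@cdef_ext _ (fun w => exists x y, range (@code A CA) x /\ range (@code B CB) y /\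
   w = hpair x y)).
  move=> w; split=> [[_ [_ [[a _ <-] [[b _ <-] ->]]]]|[[a b] _ <-]]; first by exists (a, b).
  by exists (code a), (code b); split; [exists a|split; [exists b|]].
by rewrite /cdef; pdefs; exact: code_def.
Defined.

Lemma tdefE A (CA : coded A) (P : A -> Prop) a : [set code a | a in [set a | P a]] (code a) = P a.
Proof.
by apply/propext; split=> [[a' Pa' /(@code_inj _ CA) <-] //|Pa]; exists a.
Qed.

Section typed.
Variable M : HC.
Context {A B : Type} {CA : coded A} {CB : coded B}.
Implicit Types (P Q : A -> Prop).


Lemma tdef_ext P Q : (forall a, P a <-> Q a) -> tdef M P -> tdef M Q.
Proof.
by move=> PQ; apply: cdef_ext => x; split=> -[a /PQ Pa <-]; exists a.
Qed.

Lemma tdef_not P : tdef M P -> tdef M (fun a => ~ P a).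
Proof.
move=> dP; apply: (@cdef_ext _ (fun x => range (@code A CA) x /\
    ~ [set code a | a in [set a | P a]] x)).
  move=> x; split=> [[[a _ <-]]|[a nPa <-]]; rewrite !tdefE //.
by rewrite /cdef; pdefs; exact: code_def.
Qed.

Lemma tdef_and P Q : tdef M P -> tdef M Q -> tdef M (fun a => P a /\ Q a).
Proof.
move=> dP dQ; apply: (@cdef_ext _ (fun x => [set code a | a in [set a | P a]] x /\
    [set code a | a in [set a | Q a]] x)).
  move=> x; split=> [[[a Pa <-]]|[a [Pa Qa] <-]]; rewrite !tdefE //.
by rewrite /cdef; pdefs.
Qed.

Lemma tdef_imp P Q : tdef M P -> tdef M Q -> tdef M (fun a => P a -> Q a).
Proof.
move=> dP dQ; apply: (@tdef_ext (fun a => ~ (P a /\ ~ Q a))).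
  by move=> v; rewrite not_andE notK implyE.
exact/tdef_not/tdef_and/tdef_not.
Qed.

Lemma tdef_or P Q : tdef M P -> tdef M Q -> tdef M (fun a => P a \/ Q a).
Proof.
move=> dP dQ; apply: (@tdef_ext (fun a => ~ P a -> Q a)).
  by move=> v; rewrite implyE notK.
exact/tdef_imp/dQ/tdef_not.
Qed.

Lemma tdef_iff P Q : tdef M P -> tdef M Q -> tdef M (fun a => P a <-> Q a).
Proof. by move=> dP dQ; apply: tdef_and; apply: tdef_imp. Qed.

Lemma tdef_ex (P : A -> B -> Prop) :
  tdef M (fun ab : A * B => P ab.1 ab.2) -> tdef M (fun a => exists b, P a b).
Proof.
move=> dP; apply: (@cdef_ext _ (fun x => exists y w, w = hpair x y /\
    [set code a | a in [set ab : A * B | P ab.1 ab.2]] w)).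
  move=> x; split=> [[y [w [-> [[a b] /= Pab /hpair_inj[<- _]]]]]|[a [b Pab] <-]].
    by exists a => //; exists b.
  by exists (code b), (code (a, b)); split=> //; exists (a, b).
by rewrite /cdef; pdefs.
Qed.

Definition dfun (f : A -> B) : Prop := tdef M (fun ab : A * B => ab.2 = f ab.1).

Lemma tdef_comp (P : B -> Prop) (f : A -> B) :
  dfun f -> tdef M P -> tdef M (fun a => P (f a)).
Proof.
move=> df dP; apply: (@cdef_ext _ (fun x => exists y w, w = hpair x y /\
   [set code ab | ab in [set ab : A * B | ab.2 = f ab.1]] w /\
   [set code b | b in [set b | P b]] y)).
  move=> x; split=> [[_ [w [-> [[[a b] /= -> /hpair_inj[<- <-]]]]]]|[a Pfa <-]].
    by move=> [b' Pb /(@code_inj _ CB) E]; exists a; rewrite // -E.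
  exists (code (f a)), (code (a, f a)); split=> //; split; first by exists (a, f a).
  by exists (f a).
by rewrite /cdef; pdefs.
Qed.

Lemma dfun_const (b : B) : cdef M [set code b] -> dfun (fun=> b).
Proof.
move=> db; apply: (@cdef_ext _ (fun w => exists x y, w = hpair x y /\
   range (@code A CA) x /\ [set code b] y)).
  move=> w; split=> [[x [y [-> [[a _ <-] ->]]]]|[[a b'] /= -> <-]]; first by exists (a, b).
  by exists (code a), (code b); split=> //; split=> //; exists a.
by rewrite /cdef; pdefs; exact: code_def.
Qed.

Lemma dfun_code : tdef M (fun ax : A * HC => ax.2 = code ax.1).
Proof.
apply: (@cdef_ext _ (fun w => exists x, w = hpair x x /\ range (@code A CA) x)).
  move=> w; split=> [[x [-> [a _ <-]]]|[[a b] /= -> <-]]; first by exists (a, code a).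
  by exists (code a); split=> //; exists a.
by rewrite /cdef; pdefs; exact: code_def.
Qed.

End typed.

Arguments dfun M {A B CA CB} f.

Lemma tdef_all M A B (CA : coded A) (CB : coded B) (P : A -> B -> Prop) :
  tdef M (fun ab : A * B => P ab.1 ab.2) -> tdef M (fun a => forall b, P a b).
Proof.
move=> dP; apply: (@tdef_ext _ _ _ (fun a => ~ exists b, ~ P a b)).
  move=> a; split=> [H b|H [b]]; last exact.
  by apply: contrapT => nP; apply: H; exists b.
exact/tdef_not/tdef_ex/tdef_not.
Qed.

Section dfuns.
Variable M : HC.
Context {A B C : Type} {CA : coded A} {CB : coded B} {CC : coded C}.

Lemma dfun_comp (g : B -> C) (f : A -> B) :
  dfun M f -> dfun M g -> dfun M (fun a => g (f a)).
Proof.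
move=> df dg; apply: (@cdef_ext _ (fun w => exists x y z w1 w2, w = hpair x z /\
   w1 = hpair x y /\ w2 = hpair y z /\
   [set code ab | ab in [set ab : A * B | ab.2 = f ab.1]] w1 /\
   [set code ab | ab in [set ab : B * C | ab.2 = g ab.1]] w2)).
  move=> w; split=> [[x [y [z [w1 [w2 [-> [-> [-> []]]]]]]]]|[[a c] /= -> <-]].
    move=> [[a b] /= -> /hpair_inj[<- <-]] [[b' c] /= -> /hpair_inj[/(@code_inj _ CB) -> <-]].
    by exists (a, g (f a)).
  exists (code a), (code (f a)), (code (g (f a))), (code (a, f a)), (code (f a, g (f a))).
  by do !split => //; [exists (a, f a) | exists (f a, g (f a))].
by rewrite /cdef; pdefs.
Qed.

Lemma dfun_pair (f : A -> B) (g : A -> C) :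
  dfun M f -> dfun M g -> dfun M (fun a => (f a, g a)).
Proof.
move=> df dg; apply: (@cdef_ext _ (fun w => exists x y z t w1 w2, w = hpair x t /\
   t = hpair y z /\ w1 = hpair x y /\ w2 = hpair x z /\
   [set code ab | ab in [set ab : A * B | ab.2 = f ab.1]] w1 /\
   [set code ab | ab in [set ab : A * C | ab.2 = g ab.1]] w2)).
  move=> w; split=> [[x [y [z [t [w1 [w2 [-> [-> [-> [-> []]]]]]]]]]]|[[a bc] /= -> <-]].
    move=> [[a b] /= -> /hpair_inj[<- <-]] [[a' c] /= -> /hpair_inj[/(@code_inj _ CA) -> <-]].
    by exists (a, (f a, g a)).
  exists (code a), (code (f a)), (code (g a)), (code (f a, g a)).
  exists (code (a, f a)), (code (a, g a)).
  by do !split => //; [exists (a, f a) | exists (a, g a)].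
by rewrite /cdef; pdefs.
Qed.

Lemma dfun_id : dfun M (fun a : A => a).
Proof.
apply: (@cdef_ext _ (fun w => exists x, w = hpair x x /\ range (@code A CA) x)).
  move=> w; split=> [[x [-> [a _ <-]]]|[[a b] /= -> <-]]; first by exists (a, a).
  by exists (code a); split=> //; exists a.
by rewrite /cdef; pdefs; exact: code_def.
Qed.

Lemma dfun_pr1 : dfun M (fun ab : A * B => ab.1).
Proof.
apply: (@cdef_ext _ (fun w => exists x y p, w = hpair p x /\ p = hpair x y /\
   range (@code A CA) x /\ range (@code B CB) y)).
  move=> w; split=> [[x [y [p [-> [-> [[a _ <-] [b _ <-]]]]]]]|[[[a b] c] /= -> <-]].
    by exists ((a, b), a).
  by exists (code a), (code b), (code (a, b)); do !split=> //; [exists a | exists b].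
by rewrite /cdef; pdefs; exact: code_def.
Qed.

Lemma dfun_pr2 : dfun M (fun ab : A * B => ab.2).
Proof.
apply: (@cdef_ext _ (fun w => exists x y p, w = hpair p y /\ p = hpair x y /\
   range (@code A CA) x /\ range (@code B CB) y)).
  move=> w; split=> [[x [y [p [-> [-> [[a _ <-] [b _ <-]]]]]]]|[[[a b] c] /= -> <-]].
    by exists ((a, b), b).
  by exists (code a), (code b), (code (a, b)); do !split=> //; [exists a | exists b].
by rewrite /cdef; pdefs; exact: code_def.
Qed.

End dfuns.

Section derived.
Variable M : HC.
Context {A B C D : Type} {CA : coded A} {CB : coded B} {CC : coded C} {CD : coded D}.

Lemma dfun_fst (f : A -> B * C) : dfun M f -> dfun M (fun a => (f a).1).
Proof. by move=> df; apply: (dfun_comp df); exact: dfun_pr1. Qed.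

Lemma dfun_snd (f : A -> B * C) : dfun M f -> dfun M (fun a => (f a).2).
Proof. by move=> df; apply: (dfun_comp df); exact: dfun_pr2. Qed.

Lemma dfun_codef (f : A -> B) : dfun M f -> dfun M (fun a => code (f a)).
Proof. by move=> df; apply: (dfun_comp df); exact: dfun_code. Qed.

Lemma tdef_rel (R : B -> C -> Prop) (f : A -> B) (g : A -> C) :
  tdef M (fun bc : B * C => R bc.1 bc.2) -> dfun M f -> dfun M g ->
  tdef M (fun a => R (f a) (g a)).
Proof.
by move=> dR df dg; apply: (tdef_comp (dfun_pair df dg) dR).
Qed.

Lemma dfun_fun2 (h : B -> C -> D) (f : A -> B) (g : A -> C) :
  dfun M (fun bc : B * C => h bc.1 bc.2) -> dfun M f -> dfun M g ->
  dfun M (fun a => h (f a) (g a)).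
Proof.
by move=> dh df dg; apply: (dfun_comp (dfun_pair df dg) dh).
Qed.

Lemma tdef_eq (f g : A -> B) : dfun M f -> dfun M g -> tdef M (fun a => f a = g a).
Proof.
move=> df dg; apply: (tdef_comp (dfun_pair df dg) (P := fun bb => bb.1 = bb.2)).
apply: (tdef_ext _ (@dfun_id M B CB)) => -[b b'] /=; split=> //.
Qed.

Lemma tdef_hin (f g : A -> HC) :
  dfun M f -> dfun M g -> tdef M (fun a => hin (f a) (g a)).
Proof.
move=> df dg; apply: (tdef_comp (dfun_pair df dg) (P := fun bb => hin bb.1 bb.2)).
apply: (@cdef_ext _ (fun w => exists x y, w = hpair x y /\ hin x y)).
  move=> w; split=> [[x [y [-> xy]]]|[[x y] /= xy <-]]; first by exists (x, y).
  by exists x, y.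
by rewrite /cdef; pdefs.
Qed.


End derived.

Lemma dfun_hpair M A (CA : coded A) (f g : A -> HC) :
  dfun M f -> dfun M g -> dfun M (fun a => hpair (f a) (g a)).
Proof.
by move=> df dg; apply: (dfun_codef (dfun_pair df dg)).
Qed.

(** * Codes of sequences, trees and finite maps *)


Ltac tdef_base := fail.

Ltac tdef_step :=
  cbv beta;
  lazymatch goal with
  | |- tdef _ (fun v => _ /\ _) => refine (tdef_and _ _)
  | |- tdef _ (fun v => _ \/ _) => refine (tdef_or _ _)
  | |- tdef _ (fun v => _ <-> _) => refine (tdef_iff _ _)
  | |- tdef _ (fun v => ~ _) => refine (tdef_not _)
  | |- tdef _ (fun v => @?P v -> @?Q v) => refine (tdef_imp (P := P) (Q := Q) _ _)
  | |- tdef _ (fun v => exists x, @?Q v x) => refine (tdef_ex (P := Q) _)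
  | |- tdef _ (fun v => forall x, @?Q v x) => refine (tdef_all (P := Q) _)
  | |- tdef _ (fun v => hin _ _) => refine (tdef_hin _ _)
  | |- tdef _ (fun v => _ = _) => refine (tdef_eq _ _)
  | |- dfun _ (fun v => v) => exact: dfun_id
  | |- dfun _ fst => exact: dfun_pr1
  | |- dfun _ snd => exact: dfun_pr2
  | |- dfun _ (fun v => (_).1) => refine (dfun_fst _)
  | |- dfun _ (fun v => (_).2) => refine (dfun_snd _)
  | |- dfun _ (fun v => (_, _)) => refine (dfun_pair _ _)
  | |- dfun _ (fun v => hpair _ _) => refine (dfun_hpair _ _)
  | |- dfun _ (fun v => code _) => refine (dfun_codef _)
  | |- _ => tdef_base
  end.

Ltac tdefs := repeat tdef_step.

Lemma cdef_tdef M (S : set HC) : tdef M S -> cdef M S.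
Proof. by apply: cdef_ext => x; split=> [[y Sy <-]|Sx]; [|exists x]. Qed.

Lemma cdef_hbool M : cdef M (range (fun b : bool => hnat b)).
Proof.
apply: (@cdef_ext _ (fun x => (forall z, ~ hin z x) \/
   exists e, (forall z, ~ hin z e) /\ forall z, hin z x <-> z = e));
  last by rewrite /cdef; pdefs.
move=> x; split=> [[x0|[e [e0 xE]]]|[[] _ <-]].
- by exists false => //; apply: elts_ext => z; split=> [/hin_hempty|/x0].
- exists true => //; apply: elts_ext => z; rewrite hin_hsucc xE.
  have -> : e = hempty by apply: elts_ext => t; split=> [/e0|/hin_hempty].
  by split=> [[|/hin_hempty]|->]; [|by []|left].
- right; exists hempty; split=> [z /hin_hempty //|z].
  by rewrite hin_hsucc; split=> [[|/hin_hempty]|->]; [|by []|left].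
- by left => z /hin_hempty.
Qed.

Lemma hbool_inj : injective (fun b : bool => hnat b).
Proof. by move=> [] [] /hnat_inj. Qed.

#[local] Instance coded_bool : coded bool := Coded hbool_inj cdef_hbool.

Lemma hin_hseq z s : hin z (hseq s) <->
  exists2 i, i < size s & z = hpair (hnat i) (hnat (nth false s i)).
Proof.
rewrite hin_hset; first by split=> [[i ? <-]|[i ? ->]]; exists i.
exact: countable_image.
Qed.

Lemma hin_hseq_nth (i : nat) (b : bool) s :
  hin (hpair (hnat i) (hnat b)) (hseq s) <-> i < size s /\ nth false s i = b.
Proof.
rewrite hin_hseq; split=> [[j js /hpair_inj[/hnat_inj -> /hbool_inj ->]]|[? <-]] //.
by exists i.
Qed.

Lemma hseq_sub s t : (forall z, hin z (hseq s) -> hin z (hseq t)) <-> prefix s t.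
Proof.
split=> [st|/prefixP[u ->] z].
  have H i : i < size s -> i < size t /\ nth false t i = nth false s i.
    by move=> is_; apply/hin_hseq_nth/st/hin_hseq; exists i.
  have lst : size s <= size t.
    by rewrite leqNgt; apply/negP => /H[]; rewrite ltnn.
  rewrite prefixE; apply/eqP/(@eq_from_nth _ false); rewrite size_takel //.
  by move=> i /[dup] /H[_ <-] is_; rewrite nth_take.
move=> /hin_hseq[i is_ ->]; apply/hin_hseq; exists i; last by rewrite nth_cat is_.
by rewrite size_cat ltn_addr.
Qed.

Lemma hseq_inj : injective hseq.
Proof.
move=> s t E; have st : prefix s t by apply/hseq_sub; rewrite E.
have ts : prefix t s by apply/hseq_sub; rewrite E.
have /eqP E' : size s == size t by rewrite eqn_leq !size_prefix.
by move: st; rewrite prefixE E' take_size => /eqP.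
Qed.

Lemma cdef_hseq M : cdef M (range hseq).
Proof.
apply/cdef_tdef; apply: (@tdef_ext _ _ _ (fun x : HC => exists n : nat,
  (forall z, hin z x -> exists i : nat, exists b : bool,
      hin (code i) (code n) /\ z = hpair (code i) (code b)) /\
  (forall i : nat, hin (code i) (code n) -> exists b : bool,
      forall b' : bool, hin (hpair (code i) (code b')) x <-> b' = b)));
  last by tdefs.
move=> x; split=> [[n [xn nx]]|[s _ <-]].
  pose s := mkseq (fun i => `[< hin (hpair (hnat i) (hnat true)) x >]) n.
  exists s => //; apply: elts_ext => z.
  have sb i b : i < n -> nth false s i = b <-> hin (hpair (hnat i) (hnat b)) x.
    move=> in_; have [b' b'P] := nx i ((hin_hnatE _ _).2 in_).
    have E : `[< hin (hpair (hnat i) (hnat true)) x >] = b'.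
      apply/idP/idP => [/asboolP/(b'P true) <- //|b't]; apply/asboolP.
      by apply/(b'P true); rewrite b't.
    by rewrite nth_mkseq // E; split=> [<-|/(b'P b) ->] //; exact/(b'P b').
  split.
    move=> /hin_hseq[i]; rewrite size_mkseq => in_ ->.
    exact/(sb _ _ in_).
  move=> /[dup] /xn[i [b [/hin_hnatE in_ ->]]] /= /(sb _ _ in_) <-.
  by apply/hin_hseq; exists i; rewrite ?size_mkseq.
exists (size s); split=> [z /hin_hseq[i is_ ->]|i /hin_hnatE is_].
  by exists i, (nth false s i); split => //; apply/hin_hnatE.
by exists (nth false s i) => b /=; rewrite hin_hseq_nth; split=> [[]|->].
Qed.

#[local] Instance coded_seq : coded (seq bool) := Coded hseq_inj cdef_hseq.

Lemma hin_htree z T : hin z (htree T) <-> exists2 s, T s & z = hseq s.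
Proof.
rewrite hin_hset; last exact: countable_image.
by split=> [[s Ts <-]|[s Ts ->]]; exists s.
Qed.

Lemma hin_htreeE s T : hin (hseq s) (htree T) <-> T s.
Proof. by rewrite hin_htree; split=> [[t Tt /hseq_inj ->] //|Ts]; exists s. Qed.

Lemma htree_inj : injective htree.
Proof.
move=> S T E; apply/seteqP.
by split=> s /hin_htreeE; [rewrite E|rewrite -E] => /hin_htreeE.
Qed.

Lemma cdef_htree M : cdef M (range htree).
Proof.
apply/cdef_tdef; apply: (@tdef_ext _ _ _ (fun x : HC => forall z, hin z x ->
   exists s : seq bool, z = code s)); last by tdefs.
move=> x; split=> [xs|[T _ <-] z /hin_htree[s _ ->]]; last by exists s.
exists [set s | hin (hseq s) x] => //; apply: elts_ext => z; rewrite hin_htree.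
by split=> [[s xs' ->] //|/[dup] /xs[s ->]]; exists s.
Qed.

#[local] Instance coded_tree : coded tree := Coded htree_inj cdef_htree.

Lemma cdef_omega1 M : cdef M (range (fun x : omega1 => val x)).
Proof.
apply: (@cdef_ext _ vN_ordinal).
  move=> x; split=> [ox|[y _ <-]]; last exact/asboolP/(valP y).
  by exists (exist _ x (introT (asboolP _) ox)).
by rewrite /cdef /vN_ordinal /htransitive /elts /subset /=; pdefs.
Qed.

#[local] Instance coded_omega1 : coded omega1 := Coded val_inj cdef_omega1.

(* The set of the finite subsets of x is countable, hence is itself a possible W. *)
Lemma hfiniteP x : finite_set (elts x) <-> forall W,
  (forall e, (forall z, ~ hin z e) -> hin e W) ->
  (forall y, hin y W -> forall z, hin z x ->
     forall s, (forall t, hin t s <-> t = z \/ hin t y) -> hin s W) -> hin x W.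
Proof.
have cF : countable (hset @` [set F | F `<=` elts x /\ finite_set F]).
  exact/countable_image/countable_finite_subset/elts_countable.
split=> [/finite_seqP[s xs] W W0 WS|/(_ (hset (hset @` [set F | F `<=` elts x /\ finite_set F])))].
  suff H (r : seq HC) : {subset r <= s} -> hin (hset [set` r]) W.
    suff -> : x = hset [set` s] by exact: H.
    by apply: elts_inj; rewrite elts_hset //; exact/finite_set_countable.
  have hr (r' : seq HC) z : hin z (hset [set` r']) <-> z \in r'.
    by rewrite hin_hset //; exact/finite_set_countable.
  elim: r => [_|a r IH rs].
    by apply: W0 => z; rewrite hr.
  apply: (WS _ (IH _) a).
  - by move=> z zr; apply: rs; rewrite inE zr orbT.
  - have -> : hin a x = elts x a by []. rewrite xs /=; apply: rs; exact: mem_head.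
  - by move=> t; rewrite !hr inE; split=> [/predU1P|/predU1P].
rewrite hin_hset //; case.
- move=> e e0; rewrite hin_hset //; exists set0; first by split.
  by apply: elts_ext => z; rewrite hin_hset //; split=> // /e0.
- move=> y; rewrite !hin_hset // => -[F [Fx fF] <-] z zx s sE.
  rewrite hin_hset //; exists (z |` F).
    split; first by move=> t [-> //|/Fx].
    by rewrite finite_setU; split.
  have fc := finite_set_countable fF.
  by apply: elts_ext => t; rewrite sE !hin_hset //; exact: countable_setU1.
- move=> F [Fx fF] <-; rewrite elts_hset //; exact: finite_set_countable.
Qed.

Lemma tdef_finite M : tdef M (fun x : HC => finite_set (elts x)).
Proof.
apply: tdef_ext; first by move=> x; rewrite hfiniteP; split; exact.
by tdefs.
Qed.

Section fmaps.
Context {K : choiceType} {CK : coded K}.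
Implicit Types (p q : {fmap K -> tree}).

(** An arbitrary coded key type makes this convertible to [hmtree] for keys in [omega1] and to
    [hsystem] for keys in [omega1 * nat]. *)
Definition hfmap p : HC :=
  hset [set hpair (code k) (htree (app p k)) | k in [set` domf p]].

Lemma hin_hfmap z p : hin z (hfmap p) <->
  exists2 k, k \in domf p & z = hpair (code k) (htree (app p k)).
Proof.
rewrite hin_hset; first by split=> [[k kp <-]|[k kp ->]]; exists k.
exact/countable_image.
Qed.

Lemma hin_hfmapE k T p : hin (hpair (code k) (htree T)) (hfmap p) <->
  k \in domf p /\ T = app p k.
Proof.
rewrite hin_hfmap; split=> [[l lp /hpair_inj[/(@code_inj _ CK) -> /htree_inj ->]]|[kp ->]] //.
by exists k.
Qed.

Lemma fmap_ext p q : domf p = domf q ->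
  (forall k, k \in domf p -> app p k = app q k) -> p = q.
Proof.
move=> dE H; apply/fmapP => k; have [kp|kp] := boolP (k \in domf p).
  have kq : k \in domf q by rewrite -dE.
  by have := H k kp; rewrite /app (in_fnd kp) (in_fnd kq) /= => ->.
by rewrite !not_fnd //; move: kp; rewrite dE.
Qed.

Lemma hfmap_inj : injective hfmap.
Proof.
move=> p q E.
have H k T : k \in domf p /\ T = app p k <-> k \in domf q /\ T = app q k.
  by rewrite -!hin_hfmapE E.
apply: fmap_ext => [|k kp]; last by have [] := (H k _).1 (conj kp erefl).
apply/fsetP => k; apply/idP/idP => kp.
  by have [] := (H k _).1 (conj kp erefl).
by have [] := (H k _).2 (conj kp erefl).
Qed.

Lemma exists_fmap (A : {fset K}) (F : K -> tree) :
  exists p : {fmap K -> tree}, domf p = A /\ forall k, k \in A -> app p k = F k.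
Proof.
exists [fmap k : A => F (val k)]%fmap; split=> // k kA.
by rewrite /app in_fnd /= ffunE.
Qed.

Lemma cdef_hfmap M : cdef M (range hfmap).
Proof.
apply/cdef_tdef; apply: (@tdef_ext _ _ _ (fun x : HC => finite_set (elts x) /\
   (forall z, hin z x -> exists k : K, exists T : tree, z = hpair (code k) (code T)) /\
   forall (k : K) (T T' : tree), hin (hpair (code k) (code T)) x ->
     hin (hpair (code k) (code T')) x -> T = T')); last by tdefs; exact: tdef_finite.
move=> x; split=> [[xf [xp xfun]]|[p _ <-]]; last first.
  split; last split.
  - rewrite elts_hset; first exact: finite_image.
    exact: countable_image.
  - by move=> z /hin_hfmap[k kp ->]; exists k, (app p k).
  - by move=> k T T' /hin_hfmapE[_ ->] /hin_hfmapE[_ ->].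
pose D := [set k : K | exists T : tree, hin (hpair (@code K CK k) (htree T)) x].
have Df : finite_set D.
  have [x0|/set0P[k0 Dk0]] := eqVneq D set0; first by rewrite x0.
  (* [g] reads the key off a coded pair, so [D] lies in the image of the finite set [elts x]. *)
  pose g (z : HC) : K := xget k0 [set k | exists T : tree, z = hpair (@code K CK k) (htree T)].
  apply: (@sub_finite_set _ _ (g @` elts x)); last exact: finite_image.
  move=> k [T kT]; exists (hpair (@code K CK k) (htree T)) => //.
  rewrite /g; case: xgetP => [k' _ [T' /hpair_inj[/(@code_inj _ CK) -> //]]|].
  by move/(_ k); case; exists T.
pose F k := xget set0 [set T : tree | hin (hpair (@code K CK k) (htree T)) x].
have [p [dp ap]] := exists_fmap (fset_set D) F.
exists p => //; apply: elts_ext => z; rewrite hin_hfmap.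
have FE k T : hin (hpair (@code K CK k) (htree T)) x -> F k = T.
  move=> kT; rewrite /F; case: xgetP => [T' _ /= kT'|/(_ T) //].
  exact: xfun kT' kT.
split=> [[k kp ->]|/[dup] zx /xp[k [T zE]]].
  have kD : k \in fset_set D by rewrite -dp.
  rewrite ap //; move: kD; rewrite in_fset_set // inE => -[T kT].
  by rewrite (FE _ _ kT).
rewrite zE in zx *.
have kD : k \in fset_set D by rewrite in_fset_set // inE; exists T.
by exists k; [rewrite dp|rewrite ap // (FE _ _ zx)].
Qed.

End fmaps.

Definition coded_fmap (K : choiceType) (CK : coded K) : coded {fmap K -> tree} :=
  Coded (@hfmap_inj K CK) (@cdef_hfmap K CK).

#[local] Instance coded_mtree : coded mtree := coded_fmap coded_omega1.

#[local] Instance coded_system : coded system :=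
  @coded_fmap (omega1 * nat)%type (coded_prod coded_omega1 coded_nat).

(** * Definability of conditions and of forcing *)


Lemma tdef_subset M A (CA : coded A) (S T : A -> tree) :
  dfun M S -> dfun M T -> tdef M (fun a => S a `<=` T a).
Proof.
move=> dS dT; apply: (@tdef_ext _ _ _ (fun a => forall s : seq bool,
  hin (code s) (code (S a)) -> hin (code s) (code (T a)))).
  by move=> a; split=> H s; have := H s; rewrite !hin_htreeE.
tdefs.
- apply: (dfun_comp _ dS); tdefs.
- apply: (dfun_comp _ dT); tdefs.
Qed.

Lemma tdef_prefix M A (CA : coded A) (s t : A -> seq bool) :
  dfun M s -> dfun M t -> tdef M (fun a => prefix (s a) (t a)).
Proof.
move=> ds dt; apply: (@tdef_ext _ _ _ (fun a => forall z : HC,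
  hin z (code (s a)) -> hin z (code (t a)))).
  by move=> a; exact: hseq_sub.
tdefs.
- apply: (dfun_comp _ ds); tdefs.
- apply: (dfun_comp _ dt); tdefs.
Qed.

Lemma dfun_size M A (CA : coded A) (s : A -> seq bool) :
  dfun M s -> dfun M (fun a => size (s a)).
Proof.
move=> ds; apply: (dfun_comp ds).
apply: (@tdef_ext _ _ _ (fun sn : seq bool * nat => forall i : nat,
  hin (code i) (code sn.2) <-> exists b : bool, hin (hpair (code i) (code b)) (code sn.1)));
  last by tdefs.
move=> [s' n] /=.
have E i : (exists b : bool, hin (hpair (code i) (code b)) (code s')) <-> i < size s'.
  split=> [[b /hin_hseq_nth[] //]|is_]; exists (nth false s' i); exact/hin_hseq_nth.
split=> [H|-> i]; last by rewrite E; exact: hin_hnatE.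
apply/eqP; rewrite eqn_leq; apply/andP; split; rewrite leqNgt; apply/negP.
- by move/hin_hnatE/H/E; rewrite ltnn.
- by move/E/H/hin_hnatE; rewrite ltnn.
Qed.

Lemma tdef_dom M A (CA : coded A) (K : choiceType) (CK : coded K)
    (k : A -> K) (p : A -> {fmap K -> tree}) :
  dfun M k -> @dfun M _ _ _ (coded_fmap CK) p -> tdef M (fun a => k a \in domf (p a)).
Proof.
move=> dk dp; apply: (@tdef_ext _ _ _ (fun a => exists T : tree,
  hin (hpair (code (k a)) (code T)) (@code _ (coded_fmap CK) (p a)))).
  move=> a; split=> [[T /hin_hfmapE[]] //|ka].
  by exists (app (p a) (k a)); apply/hin_hfmapE.
tdefs.
- apply: (dfun_comp _ dk); tdefs.
- apply: (dfun_comp _ dp); tdefs.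
Qed.

Lemma dfun_app M A (CA : coded A) (K : choiceType) (CK : coded K)
    (k : A -> K) (p : A -> {fmap K -> tree}) :
  @dfun M _ _ _ (coded_fmap CK) p -> dfun M k -> dfun M (fun a => app (p a) (k a)).
Proof.
move=> dp dk.
refine (@dfun_fun2 M A _ K tree CA (coded_fmap CK) CK coded_tree (@app K) p k _ dp dk).
pose CP := coded_fmap CK.
(* The second alternative is the default of [app]: the empty tree outside the domain. *)
apply: (@tdef_ext _ _ _ (fun pkT : {fmap K -> tree} * K * tree =>
  hin (hpair (code pkT.1.2) (code pkT.2)) (code pkT.1.1) \/
  ~ (pkT.1.2 \in domf pkT.1.1) /\
  forall s : seq bool, ~ hin (code s) (code pkT.2))).
  move=> [[q l] T] /=; rewrite hin_hfmapE; split=> [[[] //|[/negP lq Ts]]|->].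
    by rewrite /app not_fnd //= -subset0 => s /hin_htreeE /Ts.
  have [lq|lq] := boolP (l \in domf q); [by left|right].
  by split; [exact/negP|move=> s /hin_htreeE; rewrite /app not_fnd].
by tdefs; refine (tdef_dom (CK := CK) _ _); tdefs.
Qed.

Lemma dfun_restr M A (CA : coded A) (T : A -> tree) (s : A -> seq bool) :
  dfun M T -> dfun M s -> dfun M (fun a => restr (T a) (s a)).
Proof.
move=> dT ds; apply: (dfun_fun2 _ dT ds).
apply: (@tdef_ext _ _ _ (fun TsS : tree * seq bool * tree => forall t : seq bool,
  hin (code t) (code TsS.2) <-> hin (code t) (code TsS.1.1) /\
  (prefix TsS.1.2 t \/ prefix t TsS.1.2))).
  move=> [[S t] S'] /=; split=> [H|-> u]; last first.
    by rewrite !hin_htreeE; split=> [[? /orP]|[? /orP]].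
  apply/seteqP; split=> u; have := H u; rewrite !hin_htreeE => Hu.
    by move/Hu => [? /orP].
  by move=> [? /orP ?]; apply/Hu.
by tdefs; refine (tdef_prefix _ _); tdefs.
Qed.

Ltac tdef_base ::=
  lazymatch goal with
  | |- tdef _ (fun v => is_true (_ \in domf _)) => refine (tdef_dom _ _)
  | |- tdef _ (fun v => is_true (prefix _ _)) => refine (tdef_prefix _ _)
  | |- tdef _ (fun v => finite_set (elts _)) => refine (tdef_comp _ (tdef_finite _))
  | |- tdef _ (fun v => subset _ _) => refine (tdef_subset _ _)
  | |- dfun _ (fun v => app _ _) => refine (dfun_app _ _)
  | |- dfun _ (fun v => restr _ _) => refine (dfun_restr _ _)
  | |- dfun _ (fun v => size _) => refine (dfun_size _)
  end.

Lemma tdef_stronger M A (CA : coded A) (p q : A -> mtree) :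
  dfun M p -> dfun M q -> tdef M (fun a => stronger (p a) (q a)).
Proof.
move=> dp dq; apply: (tdef_rel _ dp dq).
apply: (@tdef_ext _ _ _ (fun pq : mtree * mtree => forall xi : omega1,
  xi \in domf pq.2 -> xi \in domf pq.1 /\ app pq.1 xi `<=` app pq.2 xi)); last by tdefs.
move=> [p' q'] /=; split=> [H|[/fsubsetP pq H] xi xiq]; last by split; [exact: pq|exact: H].
by split; [apply/fsubsetP => xi /H[]|move=> xi /H[]].
Qed.

Lemma dfun_M M A B (CA : coded A) (CB : coded B) (b : B) :
  elts M (code b) -> dfun M (fun a : A => b).
Proof. by move=> Mb; apply/dfun_const/pdef_param. Qed.

Definition forcing_tree (pi : multi) (xi : omega1) (T : tree) : Prop :=
  mdom pi xi /\ mval pi xi T.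

Section definable_notions.
Variables (M : HC) (pi : multi) (c : name).
Hypothesis pi_small : small pi.
Hypothesis pi_in_M : set_in (hmulti pi) (elts M).
Hypothesis c_in_M : set_in [set hname x | x in c] (elts M).

Lemma tdef_mdom A (CA : coded A) (xi : A -> omega1) :
  dfun M xi -> tdef M (fun a => mdom pi (xi a)).
Proof.
move=> dxi; apply: (tdef_comp dxi); have [P MP eP] := pi_in_M.
apply: (@tdef_ext _ _ _ (fun xi : omega1 => exists X : HC, hin (hpair (code xi) X) P)).
  have E z : hin z P <-> hmulti pi z by rewrite -eP.
  move=> y; split=> [[X /E[z zpi /hpair_inj[/(@code_inj _ coded_omega1) <- _]]] //|ypi].
  by eexists; apply/E; exists y.
by tdefs; exact: dfun_M.
Qed.

Lemma tdef_forcing_tree A (CA : coded A) (xi : A -> omega1) (T : A -> tree) :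
  dfun M xi -> dfun M T -> tdef M (fun a => forcing_tree pi (xi a) (T a)).
Proof.
move=> dxi dT; apply: (tdef_rel _ dxi dT); have [P MP eP] := pi_in_M.
apply: (@tdef_ext _ _ _ (fun yS : omega1 * tree => exists X : HC,
  hin (hpair (code yS.1) X) P /\ hin (code yS.2) X)).
  have E z : hin z P <-> hmulti pi z by rewrite -eP.
  (* Smallness guarantees that the inner [hset] of [hmulti] has the intended elements and is not the
     default value. *)
  have E' z y : mdom pi y -> hin z (hset (htree @` mval pi y)) <-> (htree @` mval pi y) z.
    by move=> ypi; apply: hin_hset; apply/countable_image/pi_small.2.
  move=> [y S] /=; split=> [[X []]|[ypi yS]].
    move/E => [z zpi /hpair_inj[/(@code_inj _ coded_omega1) <- <-]] /E' -/(_ zpi).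
    by move=> [S' zS' /htree_inj <-].
  exists (hset (htree @` mval pi y)); split; first by apply/E; exists y.
  by apply/E' => //; exists S.
by tdefs; exact: dfun_M.
Qed.

Lemma tdef_MTof A (CA : coded A) (p : A -> mtree) :
  dfun M p -> tdef M (fun a => MTof pi (p a)).
Proof.
move=> dp; apply: (tdef_comp dp).
apply: (@tdef_ext _ _ _ (fun q : mtree => forall xi : omega1, xi \in domf q ->
   forcing_tree pi xi (app q xi))) => //.
by tdefs; apply: tdef_forcing_tree; tdefs.
Qed.

(** Finite sets of trees are not a coded type; the finite family in [fin_unions] is quantified as
    the set X of its codes, whose finiteness is definable. *)
Lemma tdef_conds : tdef M (conds pi).
Proof.
apply: (@tdef_ext _ _ _ (fun d : cond => forall (xi : omega1) (k : nat),
   (xi, k) \in domf d.2 -> mdom pi xi /\ exists X : HC, finite_set (elts X) /\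
   (exists S : tree, hin (code S) X) /\
   (forall y : HC, hin y X -> exists S : tree, y = code S /\ forcing_tree pi xi S) /\
   forall s : seq bool, hin (code s) (code (app d.2 (xi, k))) <->
     exists S : tree, hin (code S) X /\ hin (code s) (code S))).
  move=> d; split=> H xi k /H[xipi].
    move=> [X [Xf [[S0 S0X] [XS sX]]]]; split=> //.
    pose F := [set S : tree | hin (htree S) X].
    have FX : htree @` F `<=` elts X by move=> _ [S FS <-].
    exists F; split.
    (* Decoding each element of the finite set [elts X] as a set of sequences gives a finite set of
       trees that contains F. *)
    - have [s FsE] : exists G : set tree, finite_set G /\ F `<=` G.
        exists ((fun y => [set s | hin (hseq s) y]) @` elts X); split; first exact: finite_image.
        move=> S FS; exists (htree S) => //; apply/seteqP.
        by split=> s /=; rewrite hin_htreeE.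
      exact: sub_finite_set FsE.2 FsE.1.
    - by exists S0.
    - move=> S /XS[S' [/htree_inj -> []]] //.
    - apply/seteqP; split=> s; first by move=> /hin_htreeE /(sX s)[S [SX /hin_htreeE]]; exists S.
      move=> [S SX Ss]; apply/hin_htreeE/(sX s).
      by exists S; split=> //; exact/hin_htreeE.
  move=> [F [Ff [S0 FS0] Fpi ->]]; split=> //.
  have cF : countable (htree @` F) by apply/countable_image/finite_set_countable.
  exists (hset (htree @` F)); split; last split; last split.
  - by rewrite elts_hset //; exact: finite_image.
  - by exists S0; rewrite hin_hset //; exists S0.
  - by move=> y; rewrite hin_hset // => -[S FS <-]; exists S; split=> //; split=> //; exact: Fpi.
  - move=> s; rewrite hin_htreeE; split=> [[S FS Ss]|[S [+ /hin_htreeE Ss]]].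
      by exists S; rewrite hin_hset //; split; [exists S|exact/hin_htreeE].
    by rewrite hin_hset // => -[S' FS' /htree_inj E]; exists S; rewrite // -E.
by tdefs; first [apply: tdef_forcing_tree|apply: tdef_mdom]; tdefs.
Qed.

Lemma tdef_forces_val A (CA : coded A) (p : A -> mtree) (n : A -> nat) (i : A -> bool) :
  dfun M p -> dfun M n -> dfun M i -> tdef M (fun a => forces_val c (p a) (n a) (i a)).
Proof.
move=> dp dn di; have [X MX eX] := c_in_M.
apply: (@tdef_ext _ _ _ (fun a => exists q : mtree, hin (code (q, (n a, i a))) X /\
   stronger (p a) q)).
  have E (x : mtree * (nat * bool)) : hin (code x) X <-> c x.
    change (elts X (code x) <-> c x); rewrite eX.
    split=> [[y cy yx]|cx]; last by exists x.
    have yx' : code y = code x by exact: yx.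
    by rewrite -(code_inj yx').
  by move=> a; split=> [[q [/E]]|[q /E]]; exists q.
tdefs; last (apply: tdef_stronger; tdefs); try exact: dfun_M.
- by apply: (dfun_comp _ dn); tdefs.
- by apply: (dfun_comp _ di); tdefs.
- by apply: (dfun_comp _ dp); tdefs.
Qed.

Lemma tdef_forces_notin A (CA : coded A) (p : A -> mtree) (T : A -> tree) :
  dfun M p -> dfun M T -> tdef M (fun a => forces_notin c (p a) (T a)).
Proof.
move=> dp dT; apply: (tdef_rel _ dp dT).
apply: (@tdef_ext _ _ _ (fun pT : mtree * tree => exists s : seq bool,
  ~ hin (code s) (code pT.2) /\ forall (n : nat) (b : bool),
    hin (hpair (code n) (code b)) (code s) -> forces_val c pT.1 n b)).
  move=> [q S] /=; split=> [[s [/hin_htreeE Ss H]]|[s Ss H]].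
    by exists s => // n ns; apply: (H n); apply/hin_hseq_nth.
  exists s; rewrite hin_htreeE; split=> // n b /hin_hseq_nth[ns <-].
  exact: H.
by tdefs; apply: tdef_forces_val; tdefs.
Qed.

End definable_notions.

(** Pairs of elements of M, and natural numbers, may lie outside M; what matters is that their
    singletons are definable. *)
Lemma cdef_const_pair M A B (CA : coded A) (CB : coded B) (a : A) (b : B) :
  cdef M [set code a] -> cdef M [set code b] -> cdef M [set code (a, b)].
Proof.
move=> da db; apply: (@cdef_ext _ (fun w => exists x y, w = hpair x y /\
  [set code a] x /\ [set code b] y)); last by rewrite /cdef; pdefs.
move=> w; split=> [[x [y [-> [-> ->]]]] //|->].
by exists (code a), (code b); split; [|split].
Qed.

Lemma cdef_const_nat M (n : nat) : cdef M [set code n].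
Proof.
elim: n => [|n IH].
  apply: (@cdef_ext _ (fun x => forall z, ~ hin z x)); last by rewrite /cdef; pdefs.
  move=> x; split=> [x0|-> z /hin_hempty //].
  by apply: elts_ext => z; split=> [/x0|/hin_hempty].
apply: (@cdef_ext _ (fun x => exists y, [set code n] y /\
   forall z, hin z x <-> z = y \/ hin z y)); last by rewrite /cdef; pdefs.
move=> x; split=> [[y [-> xE]]|->].
  by apply: elts_ext => z; rewrite xE; exact: (iff_sym (hin_hsucc n z)).
by exists (code n); split=> // z; exact: hin_hsucc.
Qed.

Lemma cdef_const_elt M x : elts M x -> cdef M [set x].
Proof. exact: pdef_param. Qed.

(** Membership in [W] is a finite disjunction of equalities with definable constants. This replaces
    parameters for [A], [kappa] and [p], whose codes need not belong to M. *)
Lemma tdef_finite_set M A B (CA : coded A) (CB : coded B) (W : set B) (f : A -> B) :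
  finite_set W -> (forall b, W b -> cdef M [set code b]) -> dfun M f ->
  tdef M (fun a => W (f a)).
Proof.
elim/Pchoice: B CB W f => B CB W f /finite_seqP[s ->] H df.
apply: (tdef_comp df) => {f df}.
elim: s H => [|b s IH] H.
  apply: (@cdef_ext _ (fun x => x <> x)); last by rewrite /cdef; pdefs.
  by move=> x; split=> // -[].
apply: (@cdef_ext _ (fun x => [set code b] x \/
    [set code b | b in [set b | [set` s] b]] x)).
  move=> x; split=> [[->|[a sa <-]]|[a + <-]].
  - by exists b => //=; exact: mem_head.
  - by exists a => //=; rewrite inE sa orbT.
  - by rewrite /= inE => /predU1P[->|sa]; [left|right; exists a].
apply: pdef_or; first by apply: H; exact: mem_head.
by apply: IH => a sa; apply: H; rewrite /= inE sa orbT.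
Qed.

(** Only a countable set of codes is the extension of a member of HC, so without this a dense set
    could not be an element of M^+. *)
Lemma countable_conds pi : small pi -> countable (hcond @` conds pi).
Proof.
move=> [cdom cval].
pose C : set HC := \bigcup_(x in mdom pi `*` [set: nat])
  (fun T => hpair (hpair (val x.1) (hnat x.2)) (htree T)) @` fin_unions (mval pi x.1).
have cC : countable C.
  apply: bigcup_countable => [|[xi k] [/= xipi _]]; first exact: countableX.
  apply: countable_image; apply: (@sub_countable _ _ _ ((fun F : set tree =>
    \bigcup_(S in F) S) @` [set F | F `<=` mval pi xi /\ finite_set F])).
    by apply: subset_card_le => T [F [Ff F0 Fpi ->]]; exists F.
  exact/countable_image/countable_finite_subset/cval.
pose S : set HC := hset @` [set F | F `<=` C /\ finite_set F].
have cS : countable S by exact/countable_image/countable_finite_subset.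
apply: (@sub_countable _ _ _ ((fun x => hpair x.1 x.2) @` (range hnat `*` S))); last first.
  by apply/countable_image/countableX => //; exact: countable_image.
apply: subset_card_le => _ [[n phi] /= phipi <-]; exists (hnat n, hsystem phi) => //.
split=> /=; first by exists n.
exists [set hpair (hpair (val x.1) (hnat x.2)) (htree (app phi x)) | x in [set` domf phi]] => //.
split; last exact: finite_image.
move=> _ [[xi k] /= xphi <-]; have [xipi phiU] := phipi _ _ xphi.
by exists (xi, k) => //=; exists (app phi (xi, k)).
Qed.

Section generic.
Variables (M : HC) (pi : multi) (d : nat -> cond).
Hypothesis pi_small : small pi.
Hypothesis pi_in_M : set_in (hmulti pi) (elts M).
Hypothesis generic : forall D : set cond, open_dense_conds pi D ->
  set_in (hcond @` D) (hplus M) -> exists j, D (d j).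

(** The form of genericity used below: [D] may contain pairs that are not conditions, and
    intersecting it with the definable countable set [conds pi] gives an open dense set in M^+. *)
Lemma generic_meets (D : set cond) : tdef M D ->
  (forall e e', D e -> conds pi e -> conds pi e' -> cle e' e -> D e') ->
  (forall e, conds pi e -> exists e', [/\ conds pi e', cle e' e & D e']) ->
  exists j, D (d j).
Proof.
move=> dD oD denseD; pose E := [set e | conds pi e /\ D e].
have cE : countable (hcond @` E).
  apply: sub_countable (countable_conds pi_small); apply: subset_card_le.
  by move=> _ [e [epi _] <-]; exists e.
have [||j [_ Dj]] := generic (D := E); last by exists j.
  split=> [e [] //|e e' [epi De] e'pi e'e|e /denseD[e' [e'pi e'e De']]].
    by split=> //; exact: oD De _ _ _.
  by exists e'.
exists (hset (hcond @` E)); last exact: elts_hset.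
by apply: hplus_cdef; rewrite elts_hset //; exact: (tdef_and (tdef_conds pi_small pi_in_M) dD).
Qed.

End generic.

(** * Perfect trees *)


Lemma htransitive_hpair M x y : htransitive M -> elts M (hpair x y) ->
  elts M x /\ elts M y.
Proof.
move=> Mtrans Mxy.
have Mu a b : elts M (upair a b) -> elts M a /\ elts M b.
  by move=> /Mtrans Mab; split; apply/Mab/hin_upair; [left|right].
by apply: Mu; apply: (Mtrans _ Mxy); rewrite hpairE; apply/hin_upair; right.
Qed.

(** Source of the parameters: transitivity is applied along the nested Kuratowski pairs that make up
    the code of pi. *)
Lemma htree_in_M M (pi : multi) (xi : omega1) (T : tree) :
  htransitive M -> small pi -> set_in (hmulti pi) (elts M) ->
  forcing_tree pi xi T -> elts M (val xi) /\ elts M (htree T).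
Proof.
move=> Mtrans [_ cval] [P MP eP] [xipi xiT].
have : elts M (hpair (val xi) (hset (htree @` mval pi xi))).
  by apply: (Mtrans _ MP); rewrite eP; exists xi.
move=> /(htransitive_hpair Mtrans)[Mxi /Mtrans MT]; split=> //; apply: MT.
by rewrite elts_hset; [exists T|exact/countable_image/cval].
Qed.

Lemma prefix_takeP (s t : seq bool) : prefix s t <-> take (size s) t = s.
Proof. by rewrite prefixE; split=> /eqP. Qed.

Lemma prefix_same (s t u : seq bool) :
  prefix s u -> prefix t u -> size s <= size t -> prefix s t.
Proof.
move=> /prefix_takeP su /prefix_takeP tu le.
by apply/prefix_takeP; rewrite -tu take_takel.
Qed.

Lemma prefix_comparable (s t u : seq bool) :
  prefix s u -> prefix t u -> prefix s t || prefix t s.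
Proof.
move=> su tu; case/orP: (leq_total (size s) (size t)) => le.
  by rewrite (prefix_same su tu).
by rewrite (prefix_same tu su) ?orbT.
Qed.

Lemma prefix_size_eq (s t : seq bool) :
  prefix s t || prefix t s -> size s = size t -> s = t.
Proof.
by move=> /orP[] /prefix_takeP E H; [rewrite -E H|rewrite -E -H]; rewrite take_size.
Qed.

Lemma mkseq_prefix (a : nat -> bool) m n : m <= n -> prefix (mkseq a m) (mkseq a n).
Proof.
move=> mn; apply/prefix_takeP; rewrite size_mkseq /mkseq -map_take take_iota.
by rewrite (minn_idPl mn).
Qed.

Lemma restr_sub T s : restr T s `<=` T.
Proof. by move=> t []. Qed.

Lemma restr_prefix T s t : prefix s t -> restr T t `<=` restr T s.
Proof.
move=> st u [Tu /orP[tu|ut]]; split=> //; first by rewrite (prefix_trans st tu).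
exact: prefix_comparable st ut.
Qed.

Lemma restr_mono S T s : S `<=` T -> restr S s `<=` restr T s.
Proof. by move=> ST u [/ST Tu su]. Qed.

Lemma PT_prefix T s t : PT T -> prefix s t -> T t -> T s.
Proof. by move=> [_ H _]; exact: H. Qed.

Lemma PT_nil T : PT T -> T [::].
Proof. by move=> /[dup] pT [[s Ts] _ _]; exact: PT_prefix (prefix0s s) Ts. Qed.

Lemma PT_extend T s n : PT T -> T s -> size s <= n ->
  exists t, [/\ T t, prefix s t & size t = n].
Proof.
move=> pT Ts sn.
have [t [Tt st nt]] : exists t, [/\ T t, prefix s t & n <= size t].
  elim: n {sn} => [|n [t [Tt st nt]]]; first by exists s; rewrite prefix_refl.
  have [_ _ /(_ t Tt)[u [tu uf _]]] := pT; exists (rcons u false); split=> //.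
    exact: prefix_trans st (prefix_trans tu (prefix_rcons _ _)).
  by rewrite size_rcons ltnS (leq_trans nt) // size_prefix.
exists (take n t); split; last by rewrite size_takel.
- exact: PT_prefix pT (prefix_take _ _) Tt.
- by apply: prefix_same st (prefix_take _ _) _; rewrite size_takel.
Qed.

(** Above s there is a splitting node t, and a sequence with a digit at place |t| follows at most
    one child of t. The node w runs through the other child, and h = |t| + 1 ensures that this digit
    exists. *)
Lemma PT_avoid T s : PT T -> T s -> exists h, forall a : seq bool, h <= size a ->
  exists w, [/\ T w, prefix s w, size w = size a & w <> a].
Proof.
move=> pT Ts; have [_ _ /(_ s Ts)[t [st tf tt]]] := pT.
exists (size t).+1 => a ta; pose b := ~~ nth false a (size t).
have Tb : T (rcons t b) by case: (b).
have [|w [Tw bw wa]] := PT_extend (n := size a) pT Tb; first by rewrite size_rcons.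
exists w; split=> //.
  exact: prefix_trans st (prefix_trans (prefix_rcons t b) bw).
move=> E; move: bw; rewrite E => /prefixP[u aE].
have := congr1 (fun a => nth false a (size t)) aE.
rewrite nth_cat size_rcons ltnSn nth_rcons ltnn eqxx /b.
by case: (nth _ _ _).
Qed.

Lemma finite_level (T : tree) m : finite_set (level T m).
Proof.
apply: (@sub_finite_set _ _ ((fun t : m.-tuple bool => val t) @` setT)).
  by move=> s [_ /= sm]; exists (Tuple (introT eqP sm)).
exact: finite_image.
Qed.

Lemma level_bound (f : seq bool -> nat) m :
  exists B, forall s, size s = m -> f s <= B.
Proof.
exists (\max_(t : m.-tuple bool) f t) => s sm.
exact: (leq_bigmax (Tuple (introT eqP sm))).
Qed.

Lemma fin_unions_PT P U : arboreal P -> fin_unions P U -> PT U.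
Proof.
move=> [PPT _] [F [_ [S0 FS0] FP ->]]; split.
- by have [[s S0s] _ _] := PPT _ (FP _ FS0); exists s, S0.
- by move=> s t st [S FS St]; exists S => //; apply: PT_prefix (PPT _ (FP _ FS)) st St.
- move=> s [S FS Ss]; have [_ _ /(_ _ Ss)[t [st tf tt]]] := PPT _ (FP _ FS).
  by exists t; split=> //; exists S.
Qed.

Lemma fin_unions1 P T : P T -> fin_unions P T.
Proof.
move=> PT; exists [set T]; split=> //; [by exists T|by move=> _ ->|].
by rewrite bigcup_set1.
Qed.

(** A piece of a finite union is in general only a finite union again, whereas the values of a
    multitree must come from P itself; one member of the union through s is enough. *)
Lemma fin_unions_restr P U s : arboreal P -> fin_unions P U -> U s ->
  exists V, [/\ P V, V s & V `<=` restr U s].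
Proof.
move=> [PPT Pr] [F [_ _ FP ->]] [S FS Ss]; exists (restr S s); split.
- by apply: Pr => //; exact: FP.
- by split; rewrite ?prefix_refl.
- by apply: restr_mono => t St; exists S.
Qed.

(* The tree obtained from L by replacing L|s with X s, for each s in level m. *)
Definition graft (L : tree) (m : nat) (X : seq bool -> tree) : tree :=
  \bigcup_(s in level L m) X s.

Section graft.
Variables (P : set tree) (L : tree) (m : nat) (X : seq bool -> tree).
Hypothesis arbP : arboreal P.
Hypothesis finL : fin_unions P L.
Hypothesis PX : forall s, level L m s -> P (X s).
Hypothesis XL : forall s, level L m s -> X s `<=` restr L s.

(** The perfect tree [X s] has some node of length m, and inside [restr L s] the only candidate is
    s. *)
Lemma graft_stem s : level L m s -> X s s.
Proof.
move=> Ls; have pX := arbP.1 _ (PX Ls).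
have [t [Xt _ tm]] := PT_extend (n := m) pX (PT_nil pX) (leq0n _).
have [_ /prefix_size_eq st] := XL Ls Xt.
by rewrite {2}st // tm; case: Ls.
Qed.

Lemma graft_fin : fin_unions P (graft L m X).
Proof.
have pL := fin_unions_PT arbP finL.
have [t [Lt _ tm]] := PT_extend (n := m) pL (PT_nil pL) (leq0n _).
exists (X @` level L m); split.
- exact/finite_image/finite_level.
- by exists (X t); exists t.
- by move=> _ [s Ls <-]; exact: PX.
- by rewrite bigcup_image.
Qed.

Lemma graft_sub : graft L m X `<=` L.
Proof. by move=> t [s Ls /(XL Ls)[]]. Qed.

Lemma graft_level : level (graft L m X) m = level L m.
Proof.
apply/seteqP; split=> t [Lt tm]; split=> //; first exact: graft_sub.
by exists t => //; exact: graft_stem.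
Qed.

(** Distinct stems of length m are incomparable, so another [X s'] contributes only prefixes of s,
    which [X s] contains already. *)
Lemma graft_restr s : level L m s -> restr (graft L m X) s = X s.
Proof.
move=> Ls; apply/seteqP; split=> t; last first.
  by move=> Xt; split; [exists s|case: (XL Ls Xt)].
move=> [[s' Ls' Xt] st].
have [_ s't] := XL Ls' Xt.
have sm : size s = m by case: Ls.
have s'm : size s' = m by case: Ls'.
case/orP: st => [st|ts]; last exact: PT_prefix (arbP.1 _ (PX Ls)) ts (graft_stem Ls).
suff -> : s = s' by [].
apply: prefix_size_eq; rewrite ?sm ?s'm //.
by case/orP: s't => [s't|ts']; [exact: prefix_comparable st s't|rewrite (prefix_trans st ts')].
Qed.

End graft.

(** * Conditions and the refinement relation *)


Lemma tle_refl nT : tle nT nT.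
Proof. by split. Qed.

Lemma cle_refl d : cle d d.
Proof. by split=> [|x _]; [exact: fsubset_refl|exact: tle_refl]. Qed.

Lemma cle_sub d e x : cle d e -> x \in domf e.2 -> app d.2 x `<=` app e.2 x.
Proof. by move=> [_ H] /H[]. Qed.

(** The values here are arbitrary sets of sequences, for which agreement at one level says nothing
    about lower levels; equal levels are what the use after [conds_extend] provides. *)
Lemma cle_trans_level d e f : e.1 = f.1 -> cle d e -> cle e f -> cle d f.
Proof.
move=> ef [/fsubsetP ed Hed] [/fsubsetP fe Hfe]; split; first by apply/fsubsetP => x /fe/ed.
move=> x xf; have [/= efn eT eL] := Hfe x xf; have [/= den dT dL] := Hed x (fe x xf).
split=> /=; first by rewrite -ef.
- exact: subset_trans dT eT.
- by rewrite -eL -ef.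
Qed.

Section conditions.
Variable pi : multi.
Hypothesis pi_mf : multiforcing pi.

Lemma conds_refine (m n : nat) (psi : system) (Y : omega1 * nat -> tree) :
  conds pi (m, psi) -> m <= n ->
  (forall x, x \in domf psi -> [/\ fin_unions (mval pi x.1) (Y x),
     Y x `<=` app psi x & level (Y x) m = level (app psi x) m]) ->
  exists phi : system, [/\ conds pi (n, phi), cle (n, phi) (m, psi),
    domf phi = domf psi & forall x, x \in domf psi -> app phi x = Y x].
Proof.
move=> psipi mn HY; have [phi [dphi aphi]] := exists_fmap (domf psi) Y.
exists phi; split=> //.
- move=> xi k /=; rewrite dphi => xk; rewrite aphi //.
  by have [] := psipi xi k xk; split=> //; have [] := HY _ xk.
- split=> /=; first by rewrite dphi fsubset_refl.
  by move=> x xpsi; rewrite aphi //; have [] := HY x xpsi.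
Qed.

Lemma conds_extend (m : nat) (psi : system) (W : set (omega1 * nat)) (G : omega1 * nat -> tree) :
  conds pi (m, psi) -> finite_set W ->
  (forall x, W x -> forcing_tree pi x.1 (G x)) ->
  exists phi : system, [/\ conds pi (m, phi), cle (m, phi) (m, psi),
     (forall x, W x -> x \in domf phi) &
     forall x, W x -> x \notin domf psi -> app phi x = G x].
Proof.
move=> psipi fW HG.
have [phi [dphi aphi]] := exists_fmap (domf psi `|` fset_set W)%fset
  (fun x => if x \in domf psi then app psi x else G x).
have WE x : (x \in fset_set W) <-> W x by rewrite in_fset_set // inE.
exists phi; split.
- move=> xi k; rewrite dphi => xk; rewrite aphi //; case: ifP => [xpsi|xpsi].
    exact: psipi.
  move: xk; rewrite in_fsetU xpsi => /WE /HG[? ?]; split=> //.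
  exact: fin_unions1.
- split=> /=; first by rewrite dphi fsubsetUl.
  by move=> x xpsi; rewrite aphi ?in_fsetU ?xpsi //; exact: tle_refl.
- by move=> x /WE xW; rewrite dphi in_fsetU xW orbT.
- by move=> x /WE xW /negbTE xpsi; rewrite aphi ?xpsi // in_fsetU xW orbT.
Qed.

(** New coordinates can be added without touching the level or the old trees, so density may be
    checked on conditions already defined on [W]. *)
Lemma dense_extend (W : set (omega1 * nat)) (D : set cond) :
  finite_set W -> (forall x, W x -> exists T, forcing_tree pi x.1 T) ->
  (forall e, conds pi e -> (forall x, W x -> x \in domf e.2) ->
     exists e', [/\ conds pi e', cle e' e & D e']) ->
  forall e, conds pi e -> exists e', [/\ conds pi e', cle e' e & D e'].
Proof.
move=> fW WT HD [m psi] epi.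
have /choice[G HG] x : exists T, W x -> forcing_tree pi x.1 T.
  have [/WT[T xT]|nW] := pselect (W x); first by exists T.
  by exists set0.
have [phi [phipi phipsi Wphi _]] := conds_extend epi fW HG.
have [e' [e'pi e'phi De']] := HD _ phipi Wphi.
by exists e'; split=> //; exact: cle_trans_level phipsi.
Qed.

Lemma conds_PT e x : conds pi e -> x \in domf e.2 -> PT (app e.2 x).
Proof.
case: x => xi k epi /epi[xipi]; apply: fin_unions_PT; exact: pi_mf.
Qed.

(** This set and the next two serve [refines_forcing]: a limit tree inside T, clopenness of the
    trace of [T], and T not included in Q. The finite cover is already part of being a condition. *)
Definition dense_below (xi : omega1) (T : tree) : set cond :=
  [set d | exists k : nat, (xi, k) \in domf d.2 /\ app d.2 (xi, k) `<=` T].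

Definition dense_decide (xi : omega1) (k : nat) (T : tree) : set cond :=
  [set d | (xi, k) \in domf d.2 /\ forall t, app d.2 (xi, k) t -> size t = d.1 ->
     restr (app d.2 (xi, k)) t `<=` T \/ ~ T t].

Definition dense_escape (xi : omega1) (k : nat) (T : tree) : set cond :=
  [set d | (xi, k) \in domf d.2 /\ ~ T `<=` app d.2 (xi, k)].

Lemma dense_belowP (xi : omega1) (T : tree) e : forcing_tree pi xi T -> conds pi e ->
  exists e', [/\ conds pi e', cle e' e & dense_below xi T e'].
Proof.
move=> xiT; case: e => m psi epi.
(* A second index that does not occur in psi, so that T itself can be placed there. *)
pose k := (\max_(x <- enum_fset (domf psi)) x.2).+1.
have kpsi : (xi, k) \notin domf psi.
  apply/negP => xk; have := @leq_bigmax_seq _ (enum_fset (domf psi)) xpredT snd (xi, k) xk isT.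
  by rewrite /= /k ltnn.
have [|phi [phipi phipsi Wphi Gphi]] :=
  conds_extend epi (finite_set1 (xi, k)) (G := fun=> T); first by move=> _ ->.
exists (m, phi); split=> //; exists k; split; first exact: Wphi.
by rewrite /= Gphi.
Qed.

Lemma dense_decideP xi k T e : forcing_tree pi xi T -> conds pi e ->
  exists e', [/\ conds pi e', cle e' e & dense_decide xi k T e'].
Proof.
move=> xiT; apply: (dense_extend (finite_set1 (xi, k))) => [_ ->|]; first by exists T.
move=> [m psi] epi /(_ _ erefl) /= xk.
have arbP := pi_mf xiT.1.
have [_ /= finU] := epi _ _ xk; set U := app psi (xi, k) in finU.
(* In the second alternative [VN.2] is the height from which all nodes of the piece [VN.1] are
   outside T. *)
have /choice[V HV] s : exists VN : tree * nat, level U m s ->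
    [/\ mval pi xi VN.1, VN.1 `<=` restr U s & VN.1 `<=` T \/
     forall t, VN.1 t -> VN.2 <= size t -> ~ T t].
  have [[Us sm]|] := pselect (level U m s); last by exists (set0, 0).
  have [V0 [PV0 V0s V0U]] := fin_unions_restr arbP finU Us.
  have [V0T|nV0T] := pselect (V0 `<=` T); first by exists (V0, 0) => _; split=> //; left.
  have /existsNP[t /not_implyP[V0t nTt]] := nV0T.
  exists (restr V0 t, size t) => _; split=> /=.
  - exact: arbP.2.
  - by move=> r /restr_sub /V0U.
  - right=> r [V0r /orP[tr|rt]] tr' Tr; apply: nTt.
      by apply: PT_prefix tr Tr; exact: arbP.1 xiT.2.
    suff -> : t = r by [].
    apply: prefix_size_eq; rewrite ?rt ?orbT //.
    by apply/eqP; rewrite eqn_leq tr' size_prefix.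
(* The new level will be [maxn m B]: beyond all recorded heights, and not below the old level. *)
have [B HB] := level_bound (fun s => (V s).2) m.
pose X s := (V s).1.
have PX s : level U m s -> mval pi xi (X s) by case/HV.
have XU s : level U m s -> X s `<=` restr U s by case/HV.
have [|phi [phipi phipsi dphi aphi]] :=
  conds_refine (n := maxn m B) (Y := fun x => if x == (xi, k) then graft U m X else app psi x)
    epi (leq_maxl _ _).
  move=> x xpsi; case: eqP => [->|_]; last first.
    by split=> //; case: x xpsi => zeta l /epi[].
  split; first exact: graft_fin.
  - exact: graft_sub.
  - exact: (graft_level arbP).
exists (maxn m B, phi); split=> //; split; rewrite /= ?dphi // aphi // eqxx => t [s Us Xt] tn.
have st : prefix s t.
  have [_ /orP[//|ts]] := XU s Us t Xt.
  have E : t = s; last by rewrite E prefix_refl.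
  apply: prefix_size_eq; rewrite ?ts //; apply/eqP; rewrite eqn_leq size_prefix // tn.
  by case: Us => _ ->; exact: leq_maxl.
have [_ _ [XT|nXT]] := HV s Us; [left|right].
  apply: subset_trans XT; apply: (subset_trans (restr_prefix st)).
  by rewrite (graft_restr arbP PX XU).
apply: nXT => //; rewrite tn; apply: leq_trans (leq_maxr _ _); apply: HB.
by case: Us.
Qed.

Lemma dense_escapeP xi k T e : forcing_tree pi xi T -> conds pi e ->
  exists e', [/\ conds pi e', cle e' e & dense_escape xi k T e'].
Proof.
move=> xiT; apply: (dense_extend (finite_set1 (xi, k))) => [_ ->|]; first by exists T.
move=> [m psi] epi /(_ _ erefl) /= xk.
have [TU|nTU] := pselect (T `<=` app psi (xi, k)); last first.
  by exists (m, psi); split=> //; exact: cle_refl.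
have arbP := pi_mf xiT.1; have pT := arbP.1 _ xiT.2.
have [_ /= finU] := epi _ _ xk; set U := app psi (xi, k) in finU TU.
have [s0 [Ts0 _ s0m]] := PT_extend (n := m) pT (PT_nil pT) (leq0n _).
have [h Hh] := PT_avoid pT Ts0.
(* Only the piece at s0 matters. Once it is confined to one stem a of length at least h, it misses a
   node w of T above s0 with the same length as a. *)
have /choice[X HX] s : exists X : tree, level U m s ->
    [/\ mval pi xi X, X `<=` restr U s & s = s0 ->
      exists2 a : seq bool, h <= size a & X `<=` restr U a].
  have [[Us sm]|] := pselect (level U m s); last by exists set0.
  have [V0 [PV0 V0s V0U]] := fin_unions_restr arbP finU Us.
  have [|a [V0a sa ah]] := PT_extend (n := maxn h m) (arbP.1 _ PV0) V0s.
    by rewrite sm leq_maxr.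
  exists (restr V0 a) => _; split.
  - exact: arbP.2.
  - by move=> r /restr_sub /V0U.
  - by move=> _; exists a; [rewrite ah leq_maxl|apply: restr_mono => r /V0U[]].
have PX s : level U m s -> mval pi xi (X s) by case/HX.
have XU s : level U m s -> X s `<=` restr U s by case/HX.
have [|phi [phipi phipsi dphi aphi]] :=
  conds_refine (n := m) (Y := fun x => if x == (xi, k) then graft U m X else app psi x)
    epi (leqnn _).
  move=> x xpsi; case: eqP => [->|_]; last first.
    by split=> //; case: x xpsi => zeta l /epi[].
  split; first exact: graft_fin.
  - exact: graft_sub.
  - exact: (graft_level arbP).
exists (m, phi); split=> //; split; rewrite /= ?dphi // aphi // eqxx => Tg.
have Us0 : level U m s0 by split=> //; exact: TU.
have [_ _ /(_ erefl)[a ha Xa]] := HX s0 Us0.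
have [w [Tw s0w wa]] := Hh a ha.
apply; apply: prefix_size_eq => //; rewrite orbC.
have gw : restr (graft U m X) s0 w by split; [exact: Tg|rewrite s0w].
by move: gw; rewrite (graft_restr arbP PX XU Us0) => /Xa[].
Qed.

End conditions.

(** * The density argument for sealing *)


Lemma stronger_refl p : stronger p p.
Proof. by split=> [|xi _]; [exact: fsubset_refl|]. Qed.

Lemma stronger_trans r q p : stronger r q -> stronger q p -> stronger r p.
Proof.
move=> [/fsubsetP qr Hrq] [/fsubsetP pq Hqp]; split; first by apply/fsubsetP => xi /pq/qr.
by move=> xi xip; apply: subset_trans (Hqp _ xip); exact/Hrq/pq.
Qed.

Lemma forces_init_stronger c r q a : stronger r q -> forces_init c q a -> forces_init c r a.
Proof.
move=> rq H n /H[k Kk qk]; exists k => //; exact: stronger_trans rq qk.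
Qed.

(** Completeness at the first undecided place puts a strengthening below a member of [Kset], and
    that is direct forcing of one more value. *)
Lemma forces_init_extend pi c r a h : complete_name pi c -> MTof pi r -> forces_init c r a ->
  exists r' a', [/\ MTof pi r', stronger r' r, forces_init c r' a', prefix a a' & h <= size a'].
Proof.
move=> cc rpi ra; elim: h => [|h [r1 [a1 [r1pi r1r r1a aa1 ha1]]]].
  by exists r, a; split=> //; [exact: stronger_refl|exact: prefix_refl].
have [_ /(_ _ r1pi)[r2 [q [r2pi [qpi [k Kk qk]] r2r1 r2q]]]] := cc (size a1).
have [i Ki] : exists i, Kset c (size a1) i k by case: Kk => Kk; eexists; exact: Kk.
exists r2, (rcons a1 i); split=> //.
- exact: stronger_trans r2r1 r1r.
- move=> n; rewrite size_rcons nth_rcons ltnS leq_eqVlt => /predU1P[->|na1].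
    by rewrite ltnn eqxx; exists k => //; exact: stronger_trans r2q qk.
  by rewrite na1; exact: forces_init_stronger r2r1 r1a _ na1.
- exact: prefix_trans aa1 (prefix_rcons _ _).
- by rewrite size_rcons ltnS.
Qed.

(* With A = |u| and u(xi) a subtree of Q_{xi, kappa xi}, a condition d in this set provides the
   multitree q of the sealing property; v ranges over the multitrees formed by the
   trees d(xi, kappa xi)|t with t of length d.1. *)
Definition dense_seal (pi : multi) (c : name) (eta : omega1) (K : nat) (p : mtree)
    (A : {fset omega1}) (kappa : omega1 -> nat) : set cond :=
  [set d | (forall xi, xi \in A -> (xi, kappa xi) \in domf d.2) /\
    (eta, K) \in domf d.2 /\
    exists q : mtree, MTof pi q /\ stronger q p /\ (forall xi, xi \in domf q -> xi \notin A) /\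
    forall v : mtree, (forall xi, xi \in domf v <-> xi \in A) ->
      (forall xi, xi \in A -> exists t, app d.2 (xi, kappa xi) t /\ size t = d.1 /\
          app v xi = restr (app d.2 (xi, kappa xi)) t) ->
      exists r : mtree, MTof pi r /\ (forall xi, xi \in domf r <-> xi \in A \/ xi \in domf q) /\
        (forall xi, xi \in domf q -> app r xi = app q xi) /\
        (forall xi, xi \in A -> app v xi `<=` app r xi) /\
        eta \in domf r /\ forces_notin c r (app d.2 (eta, K))].

Section seal_density.
Variables (pi : multi) (c : name) (eta : omega1) (K : nat) (p : mtree).
Variables (A : {fset omega1}) (kappa : omega1 -> nat).
Hypothesis pi_mf : multiforcing pi.
Hypothesis ppi : MTof pi p.
Hypothesis pA : forall xi, xi \in domf p -> xi \notin A.
Hypothesis cc : complete_name pi c.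
Hypothesis cn : nonprincipal pi c eta.

Section fixed_condition.
Variables (m : nat) (psi : system).
Hypothesis psipi : conds pi (m, psi).
Hypothesis Apsi : forall xi, xi \in A -> (xi, kappa xi) \in domf psi.
Hypothesis Kpsi : (eta, K) \in domf psi.

Let stems (x : omega1 * nat) : tree := level (app psi x) m.

Definition splitting (X : omega1 * nat -> seq bool -> tree) : Prop :=
  forall x s, x \in domf psi -> stems x s ->
    mval pi x.1 (X x s) /\ X x s `<=` restr (app psi x) s.

Definition side (q : mtree) : Prop :=
  [/\ MTof pi q, stronger q p & forall xi, xi \in domf q -> xi \notin A].

Definition stem_choice (tau : omega1 -> seq bool) : Prop :=
  forall xi, xi \in A -> stems (xi, kappa xi) (tau xi).

(** Quantifying over every r below the choice makes the property pass to smaller pieces and stronger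
    q, so it survives the treatment of the remaining choices. *)
Definition sealed (tau : omega1 -> seq bool) (X : omega1 * nat -> seq bool -> tree) (q : mtree) :=
  forall r : mtree,
    (forall xi, xi \in A -> xi \in domf r /\ app r xi `<=` X (xi, kappa xi) (tau xi)) ->
    stronger r q ->
    eta \in domf r /\ exists2 a, forces_init c r a & forall s, stems (eta, K) s -> ~ X (eta, K) s a.

Lemma sealed_mono tau X q X' q' : sealed tau X q -> (forall x s, X' x s `<=` X x s) ->
  stronger q' q -> sealed tau X' q'.
Proof.
move=> sX X'X q'q r rA rq'; have [||eta_r [a ra aX]] := sX r.
- by move=> xi /rA[xir rX']; split=> //; exact: subset_trans (X'X _ _).
- exact: stronger_trans rq' q'q.
- by split=> //; exists a => // s /aX nXa /X'X.
Qed.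

Lemma seal_step tau X q : stem_choice tau -> splitting X -> side q ->
  exists X' q', [/\ splitting X', forall x s, X' x s `<=` X x s, side q', stronger q' q &
    sealed tau X' q'].
Proof.
move=> htau hX [qpi qp qA].
have [r0 [dr0 ar0]] := exists_fmap (A `|` domf q)%fset
  (fun xi => if xi \in A then X (xi, kappa xi) (tau xi) else app q xi).
have r0A xi : xi \in A -> xi \in domf r0 /\ app r0 xi = X (xi, kappa xi) (tau xi).
  by move=> xiA; rewrite dr0 in_fsetU xiA ar0 ?in_fsetU ?xiA.
have r0q xi : xi \in domf q -> xi \in domf r0 /\ app r0 xi = app q xi.
  move=> xiq; rewrite dr0 in_fsetU xiq orbT ar0 ?in_fsetU ?xiq ?orbT //.
  by rewrite (negbTE (qA _ xiq)).
have r0pi : MTof pi r0.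
  move=> xi; rewrite {1}dr0 in_fsetU => /orP[xiA|xiq].
    have [_ ->] := r0A _ xiA; have [xipi _] := psipi (Apsi xiA); split=> //.
    exact: (hX _ _ (Apsi xiA) (htau _ xiA)).1.
  by have [_ ->] := r0q _ xiq; exact: qpi.
have [eta_pi [_ _ /(_ _ r0pi)[r1 [r1pi [_ eta_r1 [a1 na1 r1a1]] r1r0]]]] := cn.
have Xeta s : stems (eta, K) s -> mval pi eta (X (eta, K) s) by move=> /(hX _ _ Kpsi)[].
have arbeta := pi_mf eta_pi.
(* One h for all pieces of psi(eta, K): there are finitely many stems of length m, so the bounds
   from [PT_avoid] have a common bound. *)
have [h Hh] : exists h, forall s, stems (eta, K) s -> forall a : seq bool, h <= size a ->
    exists w, [/\ X (eta, K) s w, size w = size a & w <> a].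
  have /choice[f Hf] s : exists h, stems (eta, K) s -> forall a : seq bool, h <= size a ->
      exists w, [/\ X (eta, K) s w, size w = size a & w <> a].
    have [es|] := pselect (stems (eta, K) s); last by exists 0.
    have pX := arbeta.1 _ (Xeta _ es).
    have [h Hh] := PT_avoid pX (PT_nil pX); exists h => _ a /Hh[w [Xw _ wa nwa]].
    by exists w.
  have [B HB] := level_bound f m; exists B => s es a Ba; apply: Hf => //.
  by apply: leq_trans Ba; apply: HB; case: es.
have [r2 [a2 [r2pi r2r1 r2a2 a12 ha2]]] := forces_init_extend h cc r1pi r1a1.
have r2r0 := stronger_trans r2r1 r1r0.
have r0r2 xi : xi \in domf r0 -> xi \in domf r2 by apply/fsubsetP; case: r2r0.
have eta_r2 : eta \in domf r2 by move: eta_r1; apply/fsubsetP; case: r2r1.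
(* Lengthening a1 and shrinking r1(eta) both preserve non-membership, since r1(eta) is closed under
   prefixes. *)
have na2 : ~ app r2 eta a2.
  move=> /(r2r1.2 _ eta_r1) r1a2; apply: na1; apply: PT_prefix a12 r1a2.
  by have [etapi] := r1pi _ eta_r1; exact: arbeta.1.
have /choice[V HV] s : exists V : tree, V `<=` X (eta, K) s /\
    (stems (eta, K) s -> mval pi eta V /\ ~ V a2).
  have [es|nes] := pselect (stems (eta, K) s); last by exists (X (eta, K) s); split=> [t|/nes].
  have [w [Xw wa nwa]] := Hh s es a2 ha2.
  exists (restr (X (eta, K) s) w); split; first exact: restr_sub.
  move=> _; split; first exact: arbeta.2 (Xeta _ es) Xw.
  by move=> [_ /prefix_size_eq E]; apply: nwa; exact: E.
(* Picked pieces take priority in [X'], even when one of them belongs to psi(eta, K): there r2(eta)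
   is used instead of [V s], and [na2] keeps a2 out. *)
pose on_tau (x : omega1 * nat) (s : seq bool) :=
  [&& x.1 \in A, x.2 == kappa x.1 & s == tau x.1].
pose X' x s := if on_tau x s then app r2 x.1 else if x == (eta, K) then V s else X x s.
have on_tauX x s : on_tau x s -> app r2 x.1 `<=` X x s.
  case: x => xi k /and3P[/= xiA /eqP -> /eqP ->].
  have [xir0 <-] := r0A _ xiA; exact: r2r0.2.
have X'X x s : X' x s `<=` X x s.
  rewrite /X'; case: ifP => [/on_tauX//|_]; case: eqP => [->|_ //].
  by have [] := HV s.
(* The strengthening r2 may have acquired new coordinates, possibly eta; those outside A are
   absorbed into the side multitree. *)
have [q' [dq' aq']] := exists_fmap (domf r2 `\` A)%fset (app r2).
have q'r2 xi : xi \in domf q' -> xi \notin A /\ xi \in domf r2.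
  by rewrite dq' in_fsetD => /andP[].
have q'q : stronger q' q.
  have qq' xi : xi \in domf q -> xi \in domf q'.
    move=> xiq; rewrite dq' in_fsetD qA //; apply: r0r2; exact: (r0q _ xiq).1.
  split; first by apply/fsubsetP.
  move=> xi xiq; rewrite aq' -?dq' ?qq' //.
  by have [xir0 <-] := r0q _ xiq; exact: r2r0.2.
exists X', q'; split=> //.
- move=> x s xpsi xs; split; last by apply: subset_trans (hX _ _ xpsi xs).2; exact: X'X.
  rewrite /X'; case: ifP => [/and3P[xA _ _]|_].
    by have [] := r2pi x.1 (r0r2 _ (r0A _ xA).1).
  case: eqP xs => [-> es|_ xs]; last exact: (hX _ _ xpsi xs).1.
  by have [_ /(_ es)[]] := HV s.
- split; last by move=> xi /q'r2[].
    by move=> xi xiq'; rewrite aq' -?dq' //; apply: r2pi; exact: (q'r2 _ xiq').2.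
  exact: stronger_trans q'q qp.
- move=> r rA rq'.
  (* On A the picked pieces of [X'] are the trees of r2, and off A the trees of [q'] are, so r is
     below r2 and inherits what it forces. *)
  have rr2 : stronger r r2.
    have H xi : xi \in domf r2 -> xi \in domf r /\ app r xi `<=` app r2 xi.
      move=> xir2; have [xiA|xiA] := boolP (xi \in A).
        have [xir] := rA _ xiA; by rewrite /X' /on_tau /= xiA !eqxx.
      have xiq' : xi \in domf q' by rewrite dq' in_fsetD xiA.
      split; first by move: xiq'; apply/fsubsetP; case: rq'.
      by have := rq'.2 _ xiq'; rewrite aq' // -dq'.
    by split; [apply/fsubsetP => xi /H[]|move=> xi /H[]].
  split; first by move: eta_r2; apply/fsubsetP; case: rr2.
  exists a2; first exact: forces_init_stronger rr2 r2a2.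
  move=> s es; rewrite /X'; case: ifP => // _; rewrite eqxx.
  by have [_ /(_ es)[]] := HV s.
Qed.

Lemma seal_all : exists X q, [/\ splitting X, side q &
  forall tau, stem_choice tau -> sealed tau X q].
Proof.
(* All choices are listed through the finite type of functions from A to m-tuples; outside A, where
   [stem_choice] demands nothing, the value is empty. *)
pose tau_of (f : {ffun A -> m.-tuple bool}) (xi : omega1) : seq bool :=
  if insub xi is Some y then val (f y) else [::].
have H (fs : seq {ffun A -> m.-tuple bool}) : exists X q, [/\ splitting X, side q &
    forall f, f \in fs -> stem_choice (tau_of f) -> sealed (tau_of f) X q].
  elim: fs => [|f fs [X [q [hX hq Xq]]]].
    (* Starting point of the recursion: any tree of the forcing inside each piece of psi. *)
    have /choice[X0 HX0] (xs : (omega1 * nat) * seq bool) : exists T : tree,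
        xs.1 \in domf psi -> stems xs.1 xs.2 ->
        mval pi xs.1.1 T /\ T `<=` restr (app psi xs.1) xs.2.
      case: xs => -[xi k] s /=.
      have [[xpsi [xs _]]|nxs] := pselect ((xi, k) \in domf psi /\ stems (xi, k) s); last first.
        by exists set0 => ? ?; case: nxs.
      have [xipi finU] := psipi xpsi.
      by have [V [PV _ VU]] := fin_unions_restr (pi_mf xipi) finU xs; exists V.
    exists (fun x s => X0 (x, s)), p; split=> //; first by move=> x s; exact: (HX0 (x, s)).
    by split=> //; exact: stronger_refl.
  have [hf|nhf] := pselect (stem_choice (tau_of f)); last first.
    by exists X, q; split=> // g; rewrite inE => /predU1P[->|/Xq].
  have [X' [q' [hX' X'X hq' q'q sf]]] := seal_step hf hX hq.
  exists X', q'; split=> // g; rewrite inE => /predU1P[-> //|/Xq sg hg].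
  exact: sealed_mono (sg hg) X'X q'q.
have [X [q [hX hq Xq]]] := H (enum {: {ffun A -> m.-tuple bool}}).
exists X, q; split=> // tau htau.
pose f := [ffun y : A => insubd (nseq_tuple m false) (tau (val y))].
have tauE xi : xi \in A -> tau_of f xi = tau xi.
  move=> xiA; rewrite /tau_of insubT /= ffunE val_insubd.
  by have [_ /= ->] := htau _ xiA; rewrite eqxx.
have hf : stem_choice (tau_of f) by move=> xi xiA; rewrite tauE //; exact: htau.
move=> r rA; apply: (Xq f) => //; first by rewrite mem_enum.
by move=> xi xiA; rewrite tauE //; exact: rA.
Qed.

(** The level stays m and grafting keeps the nodes of length m, so the pieces of the new condition
    are exactly the [X x s], and each v in [dense_seal] corresponds to a choice already treated. *)
Lemma seal_dense_fixed : exists e', [/\ conds pi e', cle e' (m, psi) &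
  dense_seal pi c eta K p A kappa e'].
Proof.
have [X [q [hX hq sX]]] := seal_all.
have arb x : x \in domf psi -> arboreal (mval pi x.1).
  by case: x => xi k /psipi[/pi_mf].
have fin x : x \in domf psi -> fin_unions (mval pi x.1) (app psi x).
  by case: x => xi k /psipi[].
have PX x s : x \in domf psi -> level (app psi x) m s -> mval pi x.1 (X x s).
  by move=> xpsi xs; exact: (hX x s xpsi xs).1.
have XU x s : x \in domf psi -> level (app psi x) m s -> X x s `<=` restr (app psi x) s.
  by move=> xpsi xs; exact: (hX x s xpsi xs).2.
have [|phi [phipi phipsi dphi aphi]] := conds_refine (n := m)
    (Y := fun x => graft (app psi x) m (X x)) psipi (leqnn _).
  move=> x xpsi; split.
  - exact: graft_fin (arb _ xpsi) (fin _ xpsi) (fun s => PX x s xpsi).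
  - exact: graft_sub (fun s => XU x s xpsi).
  - exact: graft_level (arb _ xpsi) (fun s => PX x s xpsi) (fun s => XU x s xpsi).
exists (m, phi); split=> //; split; [|split] => /=.
- by move=> xi /Apsi; rewrite dphi.
- by rewrite dphi.
exists q; have [qpi qp qA] := hq; do 3!split=> //; move=> v vA Hv.
have /choice[tau Htau] xi : exists t, xi \in A -> stems (xi, kappa xi) t /\
    app v xi = X (xi, kappa xi) t.
  have [xiA|xiA] := boolP (xi \in A); last by exists [::].
  have [t [phit [tm vt]]] := Hv _ xiA; have xpsi := Apsi xiA.
  move: phit vt; rewrite aphi // => phit vt.
  have ts : stems (xi, kappa xi) t.
    by split=> //; move: phit; apply: graft_sub => s; exact: XU.
  exists t => _; split=> //.
  by rewrite vt (graft_restr (arb _ xpsi) (fun s => PX _ s xpsi) (fun s => XU _ s xpsi) ts).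
have htau : stem_choice tau by move=> xi /Htau[].
have [r [dr ar]] := exists_fmap (A `|` domf q)%fset
  (fun xi => if xi \in A then X (xi, kappa xi) (tau xi) else app q xi).
have rA xi : xi \in A -> app r xi = X (xi, kappa xi) (tau xi).
  by move=> xiA; rewrite ar ?in_fsetU ?xiA.
have rq xi : xi \in domf q -> app r xi = app q xi.
  by move=> xiq; rewrite ar ?in_fsetU ?xiq ?orbT // (negbTE (qA _ xiq)).
have [||eta_r [a ra na]] := sX tau htau r.
- by move=> xi xiA; rewrite dr in_fsetU xiA rA //; split=> // t.
- split; first by rewrite dr fsubsetUr.
  by move=> xi xiq; rewrite rq.
exists r; split.
  move=> xi; rewrite {1}dr in_fsetU => /orP[xiA|xiq]; last by rewrite rq //; exact: qpi.
  have [xipi _] := psipi (Apsi xiA); split=> //; rewrite rA //.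
  exact: (PX _ _ (Apsi xiA) (htau _ xiA)).
split; first by move=> xi; rewrite dr in_fsetU; split=> /orP.
split; first exact: rq.
split; first by move=> xi xiA; rewrite rA // (Htau _ xiA).2.
split=> //; exists a => //; rewrite aphi // => -[s es]; exact: na.
Qed.

End fixed_condition.

Lemma dense_sealP e : (forall xi, xi \in A -> exists T, forcing_tree pi xi T) ->
  (exists T, forcing_tree pi eta T) -> conds pi e ->
  exists e', [/\ conds pi e', cle e' e & dense_seal pi c eta K p A kappa e'].
Proof.
move=> AT etaT.
apply: (@dense_extend _ ((fun xi => (xi, kappa xi)) @` [set` A] `|` [set (eta, K)])).
- by rewrite finite_setU; split=> //; exact: finite_image.
- by move=> _ [[xi xiA <-]|-> //]; exact: AT.
- move=> [m psi] epi HW; apply: seal_dense_fixed => // [xi xiA|]; apply: HW; last by right.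
  by left; exists xi.
Qed.

End seal_density.

(** Truncating a stem to length [e.1] shows that each piece of the later condition lies in a piece
    of the earlier one. As r only has to cover v, the old q and r still work. *)
Lemma dense_seal_open pi c eta K p A kappa e e' : multiforcing pi ->
  dense_seal pi c eta K p A kappa e -> conds pi e -> cle e' e ->
  dense_seal pi c eta K p A kappa e'.
Proof.
move=> pi_mf [eA [eK [q [qpi [qp [qA Hq]]]]]] epi e'e.
have ee' x : x \in domf e.2 -> x \in domf e'.2 by apply/fsubsetP; case: e'e.
split; first by move=> xi /eA/ee'.
split; first exact: ee'.
exists q; do 3!split=> //; move=> v' v'A Hv'.
have /choice[w Hw] xi : exists w : tree, xi \in A ->
    app v' xi `<=` w /\ exists t, app e.2 (xi, kappa xi) t /\ size t = e.1 /\
      w = restr (app e.2 (xi, kappa xi)) t.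
  have [xiA|xiA] := boolP (xi \in A); last by exists set0.
  have [t [e't [te' v't]]] := Hv' _ xiA.
  have [/= ne _ _] := e'e.2 _ (eA _ xiA).
  have sub := cle_sub e'e (eA _ xiA).
  exists (restr (app e.2 (xi, kappa xi)) (take e.1 t)) => _; split.
    rewrite v't; apply: subset_trans (restr_mono sub) _.
    exact/restr_prefix/prefix_take.
  exists (take e.1 t); split; last by rewrite size_takel // te'.
  exact: PT_prefix (conds_PT pi_mf epi (eA _ xiA)) (prefix_take _ _) (sub _ e't).
have [v [dv av]] := exists_fmap A w.
have [||r [rpi [rd [rq [vr [eta_r [a na ra]]]]]]] := Hq v.
- by move=> xi; rewrite dv.
- by move=> xi xiA; rewrite av //; exact: (Hw _ xiA).2.
exists r; do 3!split=> //; split.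
  by move=> xi xiA; apply: subset_trans (vr _ xiA); rewrite av //; exact: (Hw _ xiA).1.
split=> //; exists a => // /(cle_sub e'e eK) //.
Qed.

(** * Definability of the dense sets *)


Lemma clopen_cylinder n (C : seq bool -> Prop) :
  @clopen cantor_space [set a : cantor_space | C (mkseq a n)].
Proof.
elim: n C => [|n IH] C.
  have [C0|nC0] := pselect (C [::]).
    have -> : [set a : cantor_space | C (mkseq a 0)] = setT by apply/seteqP; split.
    exact: clopenT.
  have -> : [set a : cantor_space | C (mkseq a 0)] = set0 by apply/seteqP; split.
  exact: clopen0.
have coord b : @clopen cantor_space [set a : cantor_space | a n = b].
  apply: (@preimage_clopen cantor_space bool (fun a => a n) [set b]).
    by split; [exact: discrete_open|exact: discrete_closed].
  exact: (@proj_continuous nat (fun=> bool) n).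
have -> : [set a : cantor_space | C (mkseq a n.+1)] =
  ([set a : cantor_space | a n = true] `&` [set a | C (rcons (mkseq a n) true)]) `|`
  ([set a : cantor_space | a n = false] `&` [set a | C (rcons (mkseq a n) false)]).
  apply/seteqP; split=> a /=; rewrite mkseqS; last by case=> -[->].
  by case E : (a n) => ?; [left|right].
by apply: clopenU; apply: clopenI => //; exact: (IH (fun s => C (rcons s _))).
Qed.

Lemma clopen_branches (S : tree) (B : set cantor_space) (E : set cantor_space) :
  @clopen cantor_space B -> branches S `&` B = branches S `&` E ->
  @clopen (subspace (branches S)) (branches S `&` E).
Proof.
move=> [oB cB] BE; have EB : B `&` branches S = (branches S `&` E) `&` branches S.
  by rewrite -BE setIC -setIA [B `&` _]setIC setIA setIid.
split; first by apply/open_subspaceP; exists B.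
by apply/closed_subspaceP; exists B.
Qed.

Section definable_dense_sets.
Variables (M : HC) (pi : multi) (c : name).
Hypothesis Mtrans : htransitive M.
Hypothesis pi_small : small pi.
Hypothesis pi_in_M : set_in (hmulti pi) (elts M).
Hypothesis c_in_M : set_in [set hname x | x in c] (elts M).

Lemma tdef_dense_below xi T : forcing_tree pi xi T -> tdef M (dense_below xi T).
Proof.
move=> /(htree_in_M Mtrans pi_small pi_in_M)[Mxi MT].
apply: (@tdef_ext _ _ _ (fun d : cond => exists k : nat,
  (xi, k) \in domf d.2 /\ app d.2 (xi, k) `<=` T)) => //.
by tdefs; exact: dfun_M.
Qed.

Lemma dfun_nat A (CA : coded A) (k : nat) : dfun M (fun a : A => k).
Proof. exact/dfun_const/cdef_const_nat. Qed.

Lemma tdef_dense_decide xi k T : forcing_tree pi xi T -> tdef M (dense_decide xi k T).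
Proof.
move=> /(htree_in_M Mtrans pi_small pi_in_M)[Mxi MT].
apply: (@tdef_ext _ _ _ (fun d : cond => (xi, k) \in domf d.2 /\ forall t : seq bool,
  hin (code t) (code (app d.2 (xi, k))) -> size t = d.1 ->
  restr (app d.2 (xi, k)) t `<=` T \/ ~ hin (code t) (code T))).
  move=> d; split=> -[dk H]; split=> // t; have := H t; rewrite !hin_htreeE //.
by tdefs; first [exact: dfun_nat|exact: dfun_M].
Qed.

Lemma tdef_dense_escape xi k T : forcing_tree pi xi T -> tdef M (dense_escape xi k T).
Proof.
move=> /(htree_in_M Mtrans pi_small pi_in_M)[Mxi MT].
apply: (@tdef_ext _ _ _ (fun d : cond => (xi, k) \in domf d.2 /\
  ~ T `<=` app d.2 (xi, k))) => //.
by tdefs; first [exact: dfun_nat|exact: dfun_M].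
Qed.

Lemma tdef_dense_seal (eta : omega1) K p (A : {fset omega1}) kappa :
  MTof pi p -> elts M (val eta) -> (forall xi, xi \in A -> elts M (val xi)) ->
  tdef M (dense_seal pi c eta K p A kappa).
Proof.
move=> ppi Meta MA.
(* [kappa] and [p] are replaced by their finite graphs, whose entries are definable constants. *)
pose W : set (omega1 * nat) := (fun xi => (xi, kappa xi)) @` [set` A].
pose Wp : set (omega1 * tree) := (fun xi => (xi, app p xi)) @` [set` domf p].
have inW xi : xi \in A -> W (xi, kappa xi) by exists xi.
have inWp xi : xi \in domf p -> Wp (xi, app p xi) by exists xi.
have finW : finite_set W by exact/finite_image/finite_fset.
have finWp : finite_set Wp by exact/finite_image/finite_fset.
have constW x : W x -> cdef M [set code x].
  move=> [xi xiA <-]; apply: cdef_const_pair; last exact: cdef_const_nat.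
  exact/cdef_const_elt/MA.
have constWp x : Wp x -> cdef M [set code x].
  move=> [xi /ppi /(htree_in_M Mtrans pi_small pi_in_M)[Mxi MT] <-].
  by apply: cdef_const_pair; exact: cdef_const_elt.
have constA (xi : omega1) : [set` A] xi -> cdef M [set code xi].
  by move=> xiA; exact/cdef_const_elt/MA.
apply: (@tdef_ext _ _ _ (fun d : cond =>
  (forall x : omega1 * nat, W x -> x \in domf d.2) /\
  (eta, K) \in domf d.2 /\
  exists q : mtree, MTof pi q /\
    (forall x : omega1 * tree, Wp x -> x.1 \in domf q /\ app q x.1 `<=` x.2) /\
    (forall xi : omega1, xi \in domf q -> ~ [set` A] xi) /\
    forall v : mtree, (forall xi : omega1, xi \in domf v <-> [set` A] xi) ->
      (forall x : omega1 * nat, W x -> exists t : seq bool,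
         hin (code t) (code (app d.2 x)) /\ size t = d.1 /\
         app v x.1 = restr (app d.2 x) t) ->
      exists r : mtree, MTof pi r /\
        (forall xi : omega1, xi \in domf r <-> [set` A] xi \/ xi \in domf q) /\
        (forall xi : omega1, xi \in domf q -> app r xi = app q xi) /\
        (forall xi : omega1, [set` A] xi -> app v xi `<=` app r xi) /\
        eta \in domf r /\ forces_notin c r (app d.2 (eta, K)))).
  move=> d; split.
    move=> [dW [deta [q [qpi [qp [qA H]]]]]].
    split; first by move=> xi xiA; apply: dW; exists xi.
    split=> //; exists q; split=> //; split.
      by split; [apply/fsubsetP|] => xi xip; have [] := qp (xi, app p xi) (inWp _ xip).
    split; first by move=> xi /qA /negP.
    move=> v vA Hv; apply: H => // _ [xi xiA <-]; have [t [dt tn]] := Hv _ xiA.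
    by exists t; split=> //; apply/hin_htreeE.
  move=> [dW [deta [q [qpi [[/fsubsetP pq qp] [qA H]]]]]].
  split; first by move=> _ [xi xiA <-]; exact: dW.
  split=> //; exists q; split=> //; split.
    by move=> _ [xi xip <-] /=; split; [exact: pq|exact: qp].
  split; first by move=> xi /qA /negP.
  move=> v vA Hv; apply: H => // xi xiA.
  have [t [/hin_htreeE dt tn]] := Hv (xi, kappa xi) (inW _ xiA).
  by exists t.
tdefs; try exact: dfun_nat; try exact: dfun_M;
  try (apply: (tdef_finite_set (W := W)) => //; tdefs);
  try (apply: (tdef_finite_set (W := Wp)) => //; tdefs);
  try (apply: (tdef_finite_set (W := [set` A])) => //; tdefs).
all: try by apply: tdef_MTof => //; tdefs.
all: apply: tdef_forces_notin => //; tdefs; try exact: dfun_nat; exact: dfun_M.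
Qed.

End definable_dense_sets.

(** * The generic refinement *)


Lemma cle_chain (d : nat -> cond) : (forall j, cle (d j.+1) (d j)) ->
  forall i j x, i <= j -> x \in domf (d i).2 ->
  x \in domf (d j).2 /\ app (d j).2 x `<=` app (d i).2 x.
Proof.
move=> dd i j x ij xi; elim: j ij => [|j IH]; first by rewrite leqn0 => /eqP <-; split.
rewrite leq_eqVlt => /predU1P[<-|]; first by split.
rewrite ltnS => /IH[xj sj].
split; first by move: xj; apply/fsubsetP; case: (dd j).
exact: subset_trans (cle_sub (dd j) xj) sj.
Qed.

Lemma limit_forcingP (d : nat -> cond) xi S : (forall j, cle (d j.+1) (d j)) ->
  limit_forcing d xi S -> exists k,
    (exists j, (xi, k) \in domf (d j).2) /\
    forall j, (xi, k) \in domf (d j).2 -> S `<=` app (d j).2 (xi, k).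
Proof.
move=> dd [k [j0 [s [dom Qs ->]]]]; exists k; split; first by exists j0; exact: dom.
move=> j xj t [Qt _].
(* Stage j may precede the final segment that defines the limit tree, hence the detour through the
   maximum of j and j0. *)
have [_] := cle_chain dd (leq_maxl j j0) xj; apply.
by apply: Qt; exact: leq_maxr.
Qed.

Lemma dense_decide_open (pi : multi) (xi : omega1) (k : nat) (T : tree) e e' :
  multiforcing pi -> PT T -> dense_decide xi k T e -> conds pi e -> cle e' e ->
  dense_decide xi k T e'.
Proof.
move=> pi_mf pT [ek H] epi e'e; split; first by move: ek; apply/fsubsetP; case: e'e.
have sub := cle_sub e'e ek; have [/= ne _ _] := e'e.2 _ ek.
move=> t e't te'; have tt := prefix_take t e.1.
have [||sT|nT] := H (take e.1 t).
- exact: PT_prefix (conds_PT pi_mf epi ek) tt (sub _ e't).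
- by rewrite size_takel // te'.
- left; apply: subset_trans sT; apply: subset_trans (restr_mono sub) _.
  exact: restr_prefix.
- by right=> Tt; apply: nT; exact: PT_prefix tt Tt.
Qed.

Section generic_refinement.
Variables (M : HC) (pi : multi) (d : nat -> cond).
Hypothesis Mtrans : htransitive M.
Hypothesis pi_mf : multiforcing pi.
Hypothesis pi_small : small pi.
Hypothesis pi_in_M : set_in (hmulti pi) (elts M).
Hypothesis dpi : forall j, conds pi (d j).
Hypothesis dd : forall j, cle (d j.+1) (d j).
Hypothesis dgen : forall D : set cond, open_dense_conds pi D ->
  set_in (hcond @` D) (hplus M) -> exists j, D (d j).

Lemma limit_forcing_refines xi : mdom pi xi ->
  refines_forcing (mval pi xi) (limit_forcing d xi).
Proof.
move=> xipi; split=> [T piT|S /(limit_forcingP dd)[k [[j xj] Sj]]|S T].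
- have xiT : forcing_tree pi xi T by [].
  have [e e' [k [ek sub]] _ _ e'e||j [k [xj jT]]] :=
    generic_meets pi_small pi_in_M dgen (tdef_dense_below Mtrans pi_small pi_in_M xiT).
  + exists k; split; first by move: ek; apply/fsubsetP; case: e'e.
    exact: subset_trans (cle_sub e'e ek) sub.
  + by move=> e; exact: dense_belowP.
  (* Restriction to the empty sequence: the limit tree itself. *)
  + exists (restr (\bigcap_(i in [set i | j <= i]) app (d i).2 (xi, k)) [::]).
      exists k, j, [::]; split=> //.
        by move=> i ji; have [] := cle_chain dd ji xj.
      move=> i ji; have [xi_i _] := cle_chain dd ji xj.
      have pi_i := conds_PT pi_mf (@dpi i) xi_i; exact: (PT_nil pi_i).
    by move=> t [/(_ j (leqnn j)) /jT].
- have [_ [F [Ff _ FP E]]] := dpi xj.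
  by exists F; split=> //; rewrite -E; exact: Sj.
- move=> /(limit_forcingP dd)[k [_ Sj]] piT.
  have xiT : forcing_tree pi xi T by [].
  split.
    have [e e' De epi _ e'e||j [xj Hj]] := generic_meets pi_small pi_in_M dgen
        (tdef_dense_decide Mtrans pi_small pi_in_M k xiT).
    + by apply: dense_decide_open De epi e'e => //; exact: (pi_mf xipi).1.
    + by move=> e; exact: dense_decideP.
    (* By [Hj] a branch of S is in [T] or not according to its node of length [(d j).1], so [T]
       agrees on [S] with a finite union of cylinders. *)
    + apply: (clopen_branches (clopen_cylinder (d j).1
         (fun t => restr (app (d j).2 (xi, k)) t `<=` T))).
      apply/seteqP; split=> a [Sa Ha]; split=> //.
        move=> n; apply: Ha; split; first exact/(Sj _ xj)/Sa.
        by case/orP: (leq_total n (d j).1) => le; rewrite (mkseq_prefix _ le) ?orbT.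
      have := Hj _ (Sj _ xj _ (Sa (d j).1)); rewrite size_mkseq => /(_ erefl)[//|].
      by case; exact: Ha.
  have [e e' [ek He] _ _ e'e||j [xj Hj]] := generic_meets pi_small pi_in_M dgen
      (tdef_dense_escape Mtrans pi_small pi_in_M k xiT).
  + split; first by move: ek; apply/fsubsetP; case: e'e.
    by move=> TU; apply: He; exact: subset_trans TU (cle_sub e'e ek).
  + by move=> e; exact: dense_escapeP.
  + by move=> TS; apply: Hj; exact: subset_trans TS (Sj _ xj).
Qed.

End generic_refinement.

Theorem theorem11p1 (M : HC) (pi rho : multi) (eta : omega1) (c : name)
    (Mtrans : htransitive M)
    (pi_mf : multiforcing pi) (pi_small : small pi)
    (pi_in_M : set_in (hmulti pi) (elts M))
    (rho_gen : generic_refinement M pi rho)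
    (eta_dom : mdom pi eta)
    (dom_in_M : forall xi : omega1, mdom pi xi -> elts M (val xi))
    (c_in_M : set_in [set hname x | x in c] (elts M))
    (c_name : real_name c) (c_complete : complete_name pi c)
    (c_nonprincipal : nonprincipal pi c eta) :
  avoids pi rho c eta.
Proof.
have [d [dpi ddec dgen rhoE]] := rho_gen.
have dd j : cle (d j.+1) (d j) by case: (ddec j).
have rdom xi : mdom rho xi <-> mdom pi xi.
  by rewrite /mdom /= rhoE; case: (pi xi).
have rval xi : mdom pi xi -> mval rho xi = limit_forcing d xi.
  by rewrite /mdom /mval /= rhoE; case: (pi xi).
have ref : refines pi rho.
  split=> xi xipi; first exact/rdom.
  rewrite rval //; exact: (limit_forcing_refines Mtrans pi_mf pi_small pi_in_M dpi dd dgen).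
split=> // Q; rewrite rval // => /(limit_forcingP dd)[K [[jK etaK] QK]].
split=> // p u ppi urho upi /fdisjointP up.
pose A := domf u.
have /choice[kappa Hkappa] xi : exists k : nat, xi \in A ->
    (exists j, (xi, k) \in domf (d j).2) /\
    forall j, (xi, k) \in domf (d j).2 -> app u xi `<=` app (d j).2 (xi, k).
  have [xiu|xiu] := boolP (xi \in A); last by exists 0.
  have [_] := urho _ xiu; rewrite rval; last exact: upi.
  by move=> /(limit_forcingP dd)[k Hk]; exists k.
have pA xi : xi \in domf p -> xi \notin A.
  by move=> xip; apply/negP => /up; rewrite xip.
have tree_at xi k j : (xi, k) \in domf (d j).2 -> exists T, forcing_tree pi xi T.
  by move=> /dpi[xipi [F [_ [T FT] FP _]]]; exists T; split=> //; exact: FP.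
have MA xi : xi \in A -> elts M (val xi) by move=> /upi; exact: dom_in_M.
have [e e' De epi _ e'e|e epi|j [dA [dK [q [qpi [qp [qA Hq]]]]]]] :=
  generic_meets pi_small pi_in_M dgen
    (tdef_dense_seal Mtrans pi_small pi_in_M c_in_M K kappa ppi (dom_in_M _ eta_dom) MA).
- exact: dense_seal_open De epi e'e.
- apply: dense_sealP => // [xi xiA|]; last exact: tree_at etaK.
  have [[i xi_i] _] := Hkappa _ xiA; exact: tree_at xi_i.
exists q; split=> //.
  by apply/fdisjointP => xi /qA.
set n := (d j).1 in Hq.
(* Each such f picks a node of length n in every d_j(xi, kappa xi); the finitely many resulting
   multitrees will cover u. *)
pose ok (f : {ffun A -> n.-tuple bool}) :=
  forall y : A, app (d j).2 (val y, kappa (val y)) (f y).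
pose Z := [set u' : mtree | [/\ MTof pi u', domf u' = domf u &
   [set r | [/\ MTof pi r, eta \in domf r & forces_notin c r Q]] (catf u' q)]].
have /choice[U HU] f : exists u' : mtree, ok f -> Z u' /\
    forall y : A, restr (app (d j).2 (val y, kappa (val y))) (f y) `<=` app u' (val y).
  have [okf|nok] := pselect (ok f); last by exists u.
  pose g xi := if insub xi is Some y then
    restr (app (d j).2 (xi, kappa xi)) (f y) else set0.
  have gE (y : A) : g (val y) = restr (app (d j).2 (val y, kappa (val y))) (f y).
    by rewrite /g valK.
  have [v [dv av]] := exists_fmap A g.
  have [||r [rpi [rd [rq [vr [eta_r [a na ra]]]]]]] := Hq v.
  - by move=> xi; rewrite dv.
  - move=> xi xiA; exists (f [` xiA]%fset); split; first exact: (okf [` xiA]%fset).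
    by rewrite size_tuple av //; split=> //; exact: (gE [` xiA]%fset).
  (* r agrees with q on |q|, so its part on A is the multitree whose union with q is r. *)
  have [u' [du' au']] := exists_fmap A (app r).
  have catE : (catf u' q) = r.
    apply: fmap_ext => [|xi].
      apply/fsetP => xi; rewrite domf_cat in_fsetU du'.
      by apply/idP/idP => [/orP xiAq|/rd xiAq]; [exact/rd|exact/orP].
    rewrite domf_cat in_fsetU du' /app fnd_cat => xiAq.
    case: ifP => [xiq|xiq]; first by have := rq _ xiq; rewrite /app => ->.
    by move: xiAq; rewrite xiq orbF => /au'; rewrite /app => ->.
  exists u' => _; split; last first.
    by move=> y; have yA := valP y; have := vr _ yA; rewrite av // au' // (gE y).
  split=> //; last first.
    (* Q lies inside d_j(eta, K), so a sequence outside the latter is outside Q. *)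
    rewrite catE; split=> //; exists a => // /(QK _ dK); exact: na.
  move=> xi; rewrite du' => xiA; rewrite au' //; apply: rpi; apply/rd; by left.
exists (U @` [set f | ok f]); split.
- exact/finite_image/finite_finset.
- by move=> _ [f /HU[Zf _] <-].
- by move=> _ [f /HU[[_ dU _] _] <-].
move=> x xu.
(* A point x of [u] selects its own initial segments of length n; the default tuple never occurs,
   since [mkseq] has length n. *)
pose f := [ffun y : A => insubd (nseq_tuple n false) (mkseq (x (val y)) n)].
have fE y : tval (f y) = mkseq (x (val y)) n.
  by rewrite ffunE; have := val_insubd (nseq_tuple n false) (mkseq (x (val y)) n);
     rewrite /= size_mkseq eqxx.
have xd (y : A) i : app (d j).2 (val y, kappa (val y)) (mkseq (x (val y)) i).
  have [_ /(_ _ (dA _ (valP y)))] := Hkappa _ (valP y); apply.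
  exact: xu (valP y) i.
have okf : ok f by move=> y; rewrite fE.
have [[_ dU _] HUf] := HU _ okf.
exists (U f); first by exists f.
move=> xi; rewrite dU => xiA i; apply: (HUf [` xiA]%fset); split; first exact: (xd [` xiA]%fset).
rewrite fE /=.
by case/orP: (leq_total n i) => le; rewrite (mkseq_prefix _ le) ?orbT.
Qed.
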